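(* The group $2V$ is simple.
   Context: Let $C\subset I=[0,1]$ be the standard middle-thirds Cantor set. A pattern is a finite set of rectangles in $I^2$ obtained from the trivial pattern $\{I^2\}$ by finitely many steps, where each step removes one rectangle $R$ of the pattern and replaces it by the two congruent rectangles obtained by dividing $R$ exactly in half by either a vertical or a horizontal line. Each rectangle $R$ occurring in a pattern corresponds to a closed and open subset $A(R)$ of $C\times C$, defined inductively: $A(I^2)=C\times C$; if $R$ is divided vertically into left half $R'$ and right half $R''$, then $A(R')$ and $A(R'')$ are the left third and right third of $A(R)$; if $R$ is divided horizontally into bottom half $R'$ and top half $R''$, then $A(R')$ and $A(R'')$ are the bottom third and top third of $A(R)$. (Here the thirds of $A(R)$ are its intersections with the corresponding closed thirds of the smallest closed rectangle containing $A(R)$.) The sets $A(R)$, for $R$ in a pattern, partition $C\times C$. A numbered pattern is a pattern with $n$ rectangles together with a bijection between $\{0,1,\ldots,n-1\}$ and its rectangles. If $P_1$ and $P_2$ are numbered patterns with the same number $n$ of rectangles, with rectangles $R_0,\ldots,R_{n-1}$ and $T_0,\ldots,T_{n-1}$ respectively (subscripts giving the numbering), then $h(P_1,P_2)$ is the self homeomorphism of $C\times C$ that takes each $A(R_i)$ onto $A(T_i)$ by the restriction of the unique map of $\mathbf{R}^2$ of the form $(x,y)\mapsto(a+3^jx,\,b+3^ky)$ with $a,b\in\mathbf{R}$, $j,k\in\mathbf{Z}$ carrying $A(R_i)$ onto $A(T_i)$. The group $2V$ is the set of all homeomorphisms $h(P_1,P_2)$ over all pairs of numbered patterns with the same number of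 rectangles, under composition. *)

(* Defs.v *)
From HB Require Import structures.
From mathcomp Require Import all_boot all_order all_algebra.
From mathcomp Require Import all_classical all_reals all_analysis.

Set Implicit Arguments.
Unset Strict Implicit.
Unset Printing Implicit Defensive.

Import Order.TTheory GRing.Theory Num.Theory.
Import numFieldNormedType.Exports.

Local Open Scope classical_set_scope.
Local Open Scope ring_scope.

Section AbstractGroups.
Local Open Scope group_scope.

Definition subgroup (gT : groupType) (H : set gT) : Prop :=
  group_closed (mem H).

(* [x ^ g] is the conjugate [g^-1 * (x * g)]. *)
Definition normal_subgroup (gT : groupType) (N G : set gT) : Prop :=
  [/\ subgroup N, N `<=` G & forall x g, N x -> G g -> N (x ^ g)].

(* The library predicate [simple] only covers finite groups. *)
Definition simple_group (gT : groupType) (G : set gT) : Prop :=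
  [/\ subgroup G, G <> [set 1] &
      forall N : set gT, normal_subgroup N G -> N = [set 1] \/ N = G].

End AbstractGroups.

Section HomeomorphismGroup.
Variable T : topologicalType.

Record homeo : Type := Homeo {
  homeo_fun :> T -> T;
  homeo_inv : T -> T;
  homeo_funK : cancel homeo_fun homeo_inv;
  homeo_invK : cancel homeo_inv homeo_fun;
  homeo_fun_continuous : continuous homeo_fun;
  homeo_inv_continuous : continuous homeo_inv }.

Lemma homeoP (f g : homeo) : homeo_fun f =1 homeo_fun g -> f = g.
Proof.
case: f g => [f f' fK f'K cf cf'] [g g' gK g'K cg cg'] /= /funext fg.
rewrite -{g}fg in gK g'K cg *.
have f'g' : f' = g' by apply/funext => x; rewrite -{1}(g'K x) fK.
rewrite -{g'}f'g' in gK g'K cg' *.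
by congr Homeo; exact: Prop_irrelevance.
Qed.

HB.instance Definition _ := gen_eqMixin homeo.
HB.instance Definition _ := gen_choiceMixin homeo.

Definition homeo_id : homeo :=
  @Homeo idfun idfun (fun=> erefl) (fun=> erefl)
    (fun x U xU => xU) (fun x U xU => xU).

Definition homeo_comp (f g : homeo) : homeo :=
  @Homeo (f \o g) (homeo_inv g \o homeo_inv f)
    (can_comp (@homeo_funK f) (@homeo_funK g))
    (can_comp (@homeo_invK g) (@homeo_invK f))
    (fun x => continuous_comp (@homeo_fun_continuous g x)
                              (@homeo_fun_continuous f (g x)))
    (fun x => continuous_comp (@homeo_inv_continuous f x)
                              (@homeo_inv_continuous g (homeo_inv f x))).

Definition homeo_opp (f : homeo) : homeo :=
  Homeo (@homeo_invK f) (@homeo_funK f)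
    (@homeo_inv_continuous f) (@homeo_fun_continuous f).

Lemma homeo_compA : associative homeo_comp.
Proof. by move=> f g h; exact: homeoP. Qed.

Lemma homeo_comp1f : left_id homeo_id homeo_comp.
Proof. by move=> f; exact: homeoP. Qed.

Lemma homeo_compf1 : right_id homeo_id homeo_comp.
Proof. by move=> f; exact: homeoP. Qed.

Lemma homeo_compVf : left_inverse homeo_id homeo_opp homeo_comp.
Proof. by move=> f; apply: homeoP => x /=; rewrite homeo_funK. Qed.

Lemma homeo_compfV : right_inverse homeo_id homeo_opp homeo_comp.
Proof. by move=> f; apply: homeoP => x /=; rewrite homeo_invK. Qed.

HB.instance Definition _ := isGroup.Build homeo
  homeo_compA homeo_comp1f homeo_compf1 homeo_compVf homeo_compfV.

End HomeomorphismGroup.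

Section TwoV.
Variable R : realType.

(* The two copies of the previous stage, scaled by 1/3, are what remains of it
   once the open middle third of each of its intervals has been removed. *)
Fixpoint cantor_stage (n : nat) : set R :=
  if n is m.+1 then
    [set x / 3 | x in cantor_stage m] `|` [set (2 + x) / 3 | x in cantor_stage m]
  else `[0, 1].

Definition cantor_set : set R := \bigcap_n cantor_stage n.

Definition cantor_square : set (R * R) := cantor_set `*` cantor_set.

(* The rectangle [xmin, xmax] x [ymin, ymax]. *)
Record rect : Type := Rect { xmin : R; xmax : R; ymin : R; ymax : R }.

Definition rect_points (B : rect) : set (R * R) :=
  `[xmin B, xmax B] `*` `[ymin B, ymax B].

Definition unit_square : rect := Rect 0 1 0 1.

Definition left_half (B : rect) : rect :=
  Rect (xmin B) ((xmin B + xmax B) / 2) (ymin B) (ymax B).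
Definition right_half (B : rect) : rect :=
  Rect ((xmin B + xmax B) / 2) (xmax B) (ymin B) (ymax B).
Definition bottom_half (B : rect) : rect :=
  Rect (xmin B) (xmax B) (ymin B) ((ymin B + ymax B) / 2).
Definition top_half (B : rect) : rect :=
  Rect (xmin B) (xmax B) ((ymin B + ymax B) / 2) (ymax B).

Definition left_third (B : rect) : rect :=
  Rect (xmin B) (xmin B + (xmax B - xmin B) / 3) (ymin B) (ymax B).
Definition right_third (B : rect) : rect :=
  Rect (xmax B - (xmax B - xmin B) / 3) (xmax B) (ymin B) (ymax B).
Definition bottom_third (B : rect) : rect :=
  Rect (xmin B) (xmax B) (ymin B) (ymin B + (ymax B - ymin B) / 3).
Definition top_third (B : rect) : rect :=
  Rect (xmin B) (xmax B) (ymax B - (ymax B - ymin B) / 3) (ymax B).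

Inductive pattern : set rect -> Prop :=
| pattern_trivial : pattern [set unit_square]
| pattern_vertical P Q : pattern P -> P Q ->
    pattern ((P `\ Q) `|` [set left_half Q; right_half Q])
| pattern_horizontal P Q : pattern P -> P Q ->
    pattern ((P `\ Q) `|` [set bottom_half Q; top_half Q]).

(* The smallest closed rectangle containing S, for S nonempty and bounded. *)
Definition bounding_rect (S : set (R * R)) : rect :=
  Rect (inf [set p.1 | p in S]) (sup [set p.1 | p in S])
       (inf [set p.2 | p in S]) (sup [set p.2 | p in S]).

(* [cantor_part Q S] says that S is the set A(Q) attached to the rectangle Q;
   it is a relation because the inductive clauses follow a sequence of
   divisions leading to Q, which need not be unique (S is nevertheless
   determined by Q). *)
Inductive cantor_part : rect -> set (R * R) -> Prop :=
| cantor_part_unit : cantor_part unit_square cantor_square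
| cantor_part_left Q S : cantor_part Q S ->
    cantor_part (left_half Q)
      (S `&` rect_points (left_third (bounding_rect S)))
| cantor_part_right Q S : cantor_part Q S ->
    cantor_part (right_half Q)
      (S `&` rect_points (right_third (bounding_rect S)))
| cantor_part_bottom Q S : cantor_part Q S ->
    cantor_part (bottom_half Q)
      (S `&` rect_points (bottom_third (bounding_rect S)))
| cantor_part_top Q S : cantor_part Q S ->
    cantor_part (top_half Q)
      (S `&` rect_points (top_third (bounding_rect S))).

Record numbered_pattern (n : nat) : Type := NumberedPattern {
  numbered_rect :> 'I_n -> rect;
  numbered_patternP :
    exists2 P : set rect, pattern P & set_bij [set: 'I_n] P numbered_rect }.

Definition triadic_affine (a b : R) (j k : int) (p : R * R) : R * R :=
  (a + 3 ^ j * p.1, b + 3 ^ k * p.2).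

(* [is_h P1 P2 f] says that f is h(P1, P2): the sets A(R_i) partition the
   Cantor square, and the affine map below is determined by A(R_i) and A(T_i),
   so that this pins down f. *)
Definition is_h (n : nat) (P1 P2 : numbered_pattern n)
    (f : homeo (set_type cantor_square)) : Prop :=
  forall i : 'I_n, exists S T : set (R * R),
    [/\ cantor_part (P1 i) S, cantor_part (P2 i) T &
      exists (a b : R) (j k : int),
        triadic_affine a b j k @` S = T /\
        forall p : set_type cantor_square, S (set_val p) ->
          set_val (f p) = triadic_affine a b j k (set_val p)].

Definition twoV : set (homeo (set_type cantor_square)) :=
  [set f | exists (n : nat) (P1 P2 : numbered_pattern n), is_h P1 P2 f].

End TwoV.

Arguments twoV : clear implicits.

(* Main.v *)
Require Import Defs.
From mathcomp Require Import all_boot all_order all_algebra.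
From mathcomp Require Import all_classical all_reals all_analysis.
From mathcomp Require Import ring lra.

(** A rectangle of a pattern is encoded by a cell, the pair of binary words that
    spell its horizontal and vertical divisions; [emb D] is the affine
    parametrisation of the piece [A(D)] by the whole Cantor square, and an
    element of 2V maps [A(D)] onto [A(E)] canonically when it sends [emb D p] to
    [emb E p] for all [p] ([carries]). Two facts make 2V manageable in these
    terms. First, every partition of the square into cells comes from a pattern
    ([partition_tiling]): a rectangle crossing the vertical middle line and one
    crossing the horizontal middle line would overlap, so one of these lines is a
    first division. Second, it follows that 2V consists of the homeomorphisms
    that carry each cell of a sufficiently fine grid to a cell
    ([twoV_cellular]), a property that is stable under composition.

    Let [N] be a nontrivial normal subgroup. Some element of [N] carries a cell
    to a disjoint one, and its commutator with the transposition of two subcells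
    is a product of two disjoint transpositions. Conjugation by elements of 2V
    moves these four cells to any four disjoint cells that leave some room; as
    the transposition of two cells is the product of the transpositions of their
    halves, [N] contains all transpositions ([transp_N]).

    The baker's map [b] of a cell [D] sends its left and right halves to its
    bottom and top halves. If [b0] and [b1] are the baker's maps of the left and
    right halves then [b * (b0 * b1) = s * (b * b)] for a transposition [s]
    ([baker_relation]): on both sides two letters are moved from the horizontal
    word to the vertical one, in different orders. If [D] is not the whole
    square, [b], [b0] and [b1] agree modulo [N], being conjugate by products of
    transpositions; so the cube of [b] is its square modulo [N], and [b] is in
    [N]. For the whole square the relation then reduces to [b = b * b] modulo [N]
    ([baker_N]).

    Finally transpositions and baker's maps generate 2V ([tilings_N]). Given two
    numbered patterns of the same size, transpositions make the last divisions of
    the two patterns correspond, a baker's map makes their directions agree, and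
    undoing both of them leaves smaller patterns. *)

Set Implicit Arguments.
Unset Strict Implicit.
Unset Printing Implicit Defensive.

Import Order.TTheory GRing.Theory Num.Theory.
Import numFieldNormedType.Exports.

Local Open Scope classical_set_scope.
Local Open Scope ring_scope.

(** * Words and the middle-thirds Cantor set *)

Notation word := (seq bool).

Section Words.
Variable R : realType.
Implicit Types (q x y : R) (u v w : word).

(** The affine contraction of the unit interval that prefixes the base [q]
    expansion of a number by the digits [0] and [q - 1] spelled by [u]. For
    [q = 2] the images of the unit interval are the dyadic intervals, for
    [q = 3] they are the intervals met in the construction of the Cantor set. *)
Fixpoint digits q u x : R :=
  if u is b :: u' then ((if b then q - 1 else 0) + digits q u' x) / q else x.

Lemma digits_cat q u v x : digits q (u ++ v) x = digits q u (digits q v x).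
Proof. by elim: u => //= b u ->. Qed.

Lemma digits_affine q u x : digits q u x = digits q u 0 + q ^- size u * x.
Proof.
elim: u => [|b u IHu] /=; first by rewrite expr0 invr1 add0r mul1r.
by rewrite IHu exprS invfM; case: b; ring.
Qed.

Lemma digits_inj q u : q != 0 -> injective (digits q u).
Proof.
move=> q0 x y; rewrite digits_affine (digits_affine q u y) => /addrI.
by apply: mulfI; rewrite invr_eq0 expf_neq0.
Qed.

Lemma digits_itv q u x : 1 <= q -> 0 <= x <= 1 -> 0 <= digits q u x <= 1.
Proof.
move=> q1 x01; elim: u => //= b u IHu; have q0 : 0 < q by lra.
by rewrite divr_ge0 ?ler_pdivrMr //; case: b; lra.
Qed.

Lemma digits_le q u x y : 1 <= q -> (digits q u x <= digits q u y) = (x <= y).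
Proof.
move=> q1; rewrite digits_affine (digits_affine q u y) lerD2l.
by rewrite ler_pM2l // invr_gt0 exprn_gt0 //; lra.
Qed.

Lemma digits_lt q u x y : 1 <= q -> (digits q u x < digits q u y) = (x < y).
Proof. by move=> q1; rewrite !ltNge digits_le. Qed.

(** Distinct words have distinct intervals: at the first letter where they
    differ the intervals are separated, and a proper prefix gives a longer
    interval. *)
Lemma digits_word_inj q u v : 2 <= q ->
  digits q u 0 = digits q v 0 -> digits q u 1 = digits q v 1 -> u = v.
Proof.
move=> q2; have q0 : 0 < q by lra. have qN0 : q != 0 by lra.
have q1 : 1 <= q by lra.
have itv w : 0 <= digits q w 0 /\ digits q w 0 < digits q w 1 /\ digits q w 1 <= 1.
  have /andP[-> _] : 0 <= digits q w 0 <= 1 by apply: digits_itv => //; lra.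
  have /andP[_ ->] : 0 <= digits q w 1 <= 1 by apply: digits_itv => //; lra.
  by rewrite digits_lt // ltr01.
have divE x y : (x / q = y) -> x = y * q by move=> <-; rewrite divfK.
elim: u v => [|b u IHu] [|c v] //=.
- have [v0 [v01 v1]] := itv v; clear itv.
  by case: c => /esym/divE h0 /esym/divE h1; exfalso; lra.
- have [u0 [u01 u1]] := itv u; clear itv.
  by case: b => /divE h0 /divE h1; exfalso; lra.
- have [u0 [u01 u1]] := itv u; have [v0 [v01 v1]] := itv v.
  clear itv; move=> /divE; rewrite divfK // => h0 /divE; rewrite divfK // => h1.
  have bc : b = c by case: b c h0 h1 => [] [] // h0 h1; exfalso; lra.
  by rewrite bc in h0 h1 *; rewrite (IHu v) //; move: h0 h1; case: (c) => h0 h1; lra.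
Qed.

Notation C := (@cantor_set R).

Lemma cantor_itv x : C x -> 0 <= x <= 1.
Proof. by move=> /(_ 0 I); rewrite /= in_itv. Qed.

Lemma cantor0 : C 0.
Proof.
move=> n _; elim: n => [|n IHn] /=; first by rewrite in_itv /= lexx ler01.
by left; exists 0 => //; rewrite mul0r.
Qed.

Lemma cantor1 : C 1.
Proof.
move=> n _; elim: n => [|n IHn] /=; first by rewrite in_itv /= lexx ler01.
by right; exists 1 => //; lra.
Qed.

Lemma cantor_digits u x : C x -> C (digits 3 u x).
Proof.
move=> Cx; elim: u => //= b u IHu [|n] _ /=.
  have := cantor_itv IHu; rewrite in_itv /=; case: b; lra.
case: b; [right|left]; exists (digits 3 u x); try exact: IHu.
- by congr (_ / _); lra.
- by rewrite add0r.
Qed.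

Lemma cantor_stage_itv n x : @cantor_stage R n x -> 0 <= x <= 1.
Proof.
elim: n x => [|n IHn] x /=; first by rewrite in_itv.
by case=> -[y /IHn y01 <-]; lra.
Qed.

(** Which of the two thirds a point lies in is already decided by the first
    stage, so that the same choice works at all stages. *)
Lemma cantor_split x : C x -> exists b y, C y /\ x = digits 3 [:: b] y.
Proof.
move=> Cx; have := Cx 1%N I; case=> -[y0 /(@cantor_stage_itv 0) y01 xE].
- exists false, (3 * x); split=> [n _|/=]; last by lra.
  case: (Cx n.+1 I) => -[y ny yE]; first by rewrite -yE mulrC divfK.
  by have := cantor_stage_itv ny; lra.
- exists true, (3 * x - 2); split=> [n _|/=]; last by lra.
  case: (Cx n.+1 I) => -[y ny yE]; first by have := cantor_stage_itv ny; lra.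
  by rewrite (_ : _ - 2 = y) //; lra.
Qed.

(** The pieces of the Cantor set indexed by words form a tree: two of them that
    meet are nested, and the coordinates inside them correspond. *)
Lemma cantor_prefix u v x y : C x -> C y -> (size u <= size v)%N ->
  digits 3 u x = digits 3 v y -> exists w, v = u ++ w /\ x = digits 3 w y.
Proof.
move=> Cx Cy; elim: u v => [|b u IHu] [|c v] //= uv; last first.
  have := cantor_itv (cantor_digits u Cx); have := cantor_itv (cantor_digits v Cy).
  move=> vy ux; have [->|bc] := eqVneq b c.
    have div3_inj (s t : R) : s / 3 = t / 3 -> s = t by lra.
    by move=> /div3_inj/addrI/(IHu _ uv) [w [-> ->]]; exists w.
  by case: b c bc => [] [] //= _ h; exfalso; lra.
- by move=> xy; exists (c :: v).
- by move=> xy; exists [::].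
Qed.

(** The intervals of rank [n] of the Cantor set are at distance at least
    [3 ^ -n] from each other. *)
Lemma cantor_close u x y : C x -> C y ->
  `|y - digits 3 u x| < 3 ^- size u -> exists2 z, C z & y = digits 3 u z.
Proof.
move=> Cx Cy; elim: u y Cy => [|b u IHu] y Cy /=; first by exists y.
have [c [z [Cz ->]]] := cantor_split Cy => /=.
have e1 : 3 ^- (size u).+1 = 3 ^- size u / 3 :> R.
  by rewrite exprS invfM mulrC.
have e2 : 0 < (3 : R) ^- size u <= 1.
  by rewrite invr_gt0 exprn_gt0 //= invf_le1 ?exprn_gt0 // exprn_ege1 //; lra.
rewrite e1; have ux := cantor_itv (cantor_digits u Cx); have zi := cantor_itv Cz.
rewrite ltr_norml => /andP[h1 h2].
have cb : c = b by case: c b h1 h2 => [] [] //=; lra.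
have /IHu [//|t Ct ->] : `|z - digits 3 u x| < 3 ^- size u.
  by rewrite ltr_norml; move: h1 h2; rewrite cb; case: (b); lra.
by exists t; rewrite // cb.
Qed.

End Words.

(** * Cells of the Cantor square *)

Definition cell := (word * word)%type.
(** Words are read from the coarsest digit on, so that [D +++ E] is the copy of
    [E] inside [D]. *)
Definition ccat (D E : cell) : cell := (D.1 ++ E.1, D.2 ++ E.2).
Notation "D +++ E" := (ccat D E) (at level 50, left associativity).
Definition whole : cell := ([::], [::]).
(** The two parts of the square cut by a vertical line, for [d] true, or by a
    horizontal one. Having the direction as a parameter lets both kinds of
    division share their proofs. *)
Definition side (d b : bool) : cell := if d then ([:: b], [::]) else ([::], [:: b]).
Definition level m (D : cell) := (size D.1 == m) && (size D.2 == m).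

Lemma ccatA : associative ccat.
Proof. by move=> [a b] [c d] [e f]; rewrite /ccat /= !catA. Qed.

Lemma ccat0 D : D +++ whole = D.
Proof. by case: D => a b; rewrite /ccat /= !cats0. Qed.

(** If one word extends the other, the first additional letter [b] of the longer
    one is contradicted by continuing both words with [~~ b]. *)
Lemma word_sep u v : u <> v ->
  exists s w b t t', u ++ s = w ++ b :: t /\ v ++ s = w ++ ~~ b :: t'.
Proof.
elim: u v => [|b u IHu] [|c v] //= uv.
- by exists [:: ~~ c], [::], (~~ c), [::], (v ++ [:: ~~ c]); rewrite negbK.
- by exists [:: ~~ b], [::], b, (u ++ [:: ~~ b]), [::].
- have [bc|/negbTE bc] := eqVneq b c.
    have /IHu : u <> v by move=> e; apply: uv; rewrite bc e.
    move=> [s [w [d [t [t' [e e']]]]]].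
    by exists s, (b :: w), d, t, t'; rewrite -bc /= e e'.
  exists [::], [::], b, (u ++ [::]), (v ++ [::]); split=> //.
  by congr (_ :: _); move: bc; case: b c {uv IHu} => [] [].
Qed.

Section Cells.
Variable R : realType.

Definition cantor_point := set_type (@cantor_square R).
Implicit Types (p q : cantor_point) (D E F G : cell) (f g : cantor_point -> cantor_point).

Lemma emb_subproof D p :
  cantor_square (digits 3 D.1 (set_val p).1, digits 3 D.2 (set_val p).2).
Proof.
by have [px py] := set_valP p; split; apply: cantor_digits.
Qed.

(** The canonical affine bijection from the whole Cantor square onto the piece
    [A(D)]. *)
Definition emb D p : cantor_point := SigSub (mem_set (emb_subproof D p)).

Lemma point_eqP p q : (set_val p).1 = (set_val q).1 ->
  (set_val p).2 = (set_val q).2 -> p = q.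
Proof.
by move=> e1 e2; apply: val_inj; rewrite /= [LHS]surjective_pairing e1 e2 -surjective_pairing.
Qed.

Lemma emb_cat D E p : emb (D +++ E) p = emb D (emb E p).
Proof. by apply: point_eqP; rewrite /= digits_cat. Qed.

Lemma emb_whole p : emb whole p = p.
Proof. exact: point_eqP. Qed.

Lemma emb_inj D : injective (emb D).
Proof.
have n3 : 3 != 0 :> R by [].
move=> p q /(congr1 set_val) /= [e1 e2].
by apply: point_eqP; [apply: digits_inj e1|apply: digits_inj e2].
Qed.

Definition mkpoint x y (Cx : cantor_set x) (Cy : cantor_set y) : cantor_point :=
  SigSub (mem_set (conj Cx Cy : cantor_square (x, y))).

Lemma side_cover d p : exists b q, p = emb (side d b) q.
Proof.
have [px py] := set_valP p; case: d.
- have [b [t [Ct e]]] := cantor_split px.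
  by exists b, (mkpoint Ct py); apply: point_eqP.
- have [b [t [Ct e]]] := cantor_split py.
  by exists b, (mkpoint px Ct); apply: point_eqP.
Qed.

Lemma level_cover m p : exists D q, level m D /\ p = emb D q.
Proof.
elim: m => [|m [D [q [/andP[/eqP D1 /eqP D2] ->]]]].
  by exists whole, p; rewrite emb_whole.
have [b [q1 ->]] := side_cover true q; have [c [q2 ->]] := side_cover false q1.
exists (D +++ side true b +++ side false c), q2.
by rewrite !emb_cat /level /= !size_cat /= D1 D2 !addn0 !addn1 eqxx.
Qed.

Definition disj D E := forall p q, emb D p <> emb E q.

Lemma disj_sym D E : disj D E -> disj E D.
Proof. by move=> h p q /esym; exact: h. Qed.

Lemma disj_cat D E F G : disj D E -> disj (D +++ F) (E +++ G).
Proof. by move=> h p q; rewrite !emb_cat; exact: h. Qed.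

Lemma disj_cat1 D E F : disj D E -> disj (D +++ F) E.
Proof. by move=> h p q; rewrite emb_cat; exact: h. Qed.

Lemma disj_catl D E F : disj E F -> disj (D +++ E) (D +++ F).
Proof. by move=> h p q; rewrite !emb_cat => /emb_inj; exact: h. Qed.

Lemma disj_side d b : disj (side d b) (side d (~~ b)).
Proof.
move=> p q; have [/cantor_itv px /cantor_itv py] := set_valP p.
have [/cantor_itv qx /cantor_itv qy] := set_valP q.
by move=> /(congr1 set_val); case: d b => [] [] /= [] e e'; exfalso; lra.
Qed.

Lemma disjxx D p : ~ disj D D.
Proof. by move=> /(_ p p). Qed.

(** Cells that meet need not be nested, since one can be wider and the other
    taller; they are as soon as one of them is at least as fine as the other in
    both directions. This is why uniform grids are used to refine cells. *)
Lemma emb_prefix D E p q : (size D.1 <= size E.1)%N -> (size D.2 <= size E.2)%N ->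
  emb D p = emb E q -> exists F, E = D +++ F /\ p = emb F q.
Proof.
have [px py] := set_valP p; have [qx qy] := set_valP q.
move=> s1 s2 /(congr1 set_val) /= [e1 e2].
have [w1 [E1 p1]] := cantor_prefix px qx s1 e1.
have [w2 [E2 p2]] := cantor_prefix py qy s2 e2.
exists (w1, w2); split; last exact: point_eqP.
by rewrite /ccat -E1 -E2 -surjective_pairing.
Qed.

(** Two distinct cells can be told apart at the same place: some common
    continuation of them leads to disjoint cells. *)
Lemma disj_sep D E : D <> E -> exists F, disj (D +++ F) (E +++ F).
Proof.
case: D E => [D1 D2] [E1 E2] DE.
have [D1E1|] := pselect (D1 = E1); last first.
  move=> /word_sep [s [w [b [t [t' [e e']]]]]]; exists (s, [::]).
  rewrite (_ : _ +++ _ = (w, [::]) +++ side true b +++ (t, D2)); last first.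
    by rewrite /ccat /= cats0 e -catA.
  rewrite (_ : (E1, E2) +++ _ = (w, [::]) +++ side true (~~ b) +++ (t', E2)).
    by apply: disj_cat; apply: disj_catl; apply: disj_side.
  by rewrite /ccat /= cats0 e' -catA.
have /word_sep : D2 <> E2 by move=> e; apply: DE; rewrite D1E1 e.
move=> [s [w [b [t [t' [e e']]]]]]; exists ([::], s).
rewrite (_ : _ +++ _ = ([::], w) +++ side false b +++ (D1, t)); last first.
  by rewrite /ccat /= cats0 e -catA.
rewrite (_ : (E1, E2) +++ _ = ([::], w) +++ side false (~~ b) +++ (E1, t')).
  by apply: disj_cat; apply: disj_catl; apply: disj_side.
by rewrite /ccat /= cats0 e' -catA.
Qed.

Lemma disj_sub D E : exists F G, disj (D +++ F) (E +++ G).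
Proof.
have [->|/disj_sep[F DE]] := pselect (D = E); last by exists F, F.
by exists (side true true), (side true false); apply/disj_catl/disj_side.
Qed.

(** Equivalently, [f] restricts to the unique affine map with positive ratios
    from [A(D)] onto [A(E)]. *)
Definition carries f D E := forall p, f (emb D p) = emb E p.

Lemma carries_cat f D E F : carries f D E -> carries f (D +++ F) (E +++ F).
Proof. by move=> fDE p; rewrite !emb_cat fDE. Qed.

(** This local condition turns out to describe 2V, and is easier to compose
    than pairs of patterns. *)
Definition cellular f := exists m, forall D, level m D -> exists E, carries f D E.

Lemma cellular_fine f m D : (forall D, level m D -> exists E, carries f D E) ->
  (m <= size D.1)%N -> (m <= size D.2)%N -> exists E, carries f D E.
Proof.
move=> fm D1 D2; pose F := (take m D.1, take m D.2).
have DF : D = F +++ (drop m D.1, drop m D.2).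
  by rewrite /ccat /= !cat_take_drop -surjective_pairing.
have /fm [E fFE] : level m F by rewrite /level /= !size_takel // !eqxx.
by rewrite DF; eexists; apply: carries_cat fFE.
Qed.

Lemma cellular_comp f g : cellular f -> cellular g -> cellular (f \o g).
Proof.
(* [g] forgets at most [n] letters of a word, which leaves [m] letters for [f]. *)
move=> [m fm] [n gn]; exists (n + m)%N => D /andP[/eqP D1 /eqP D2].
pose D' := (take n D.1, take n D.2); pose F := (drop n D.1, drop n D.2).
have DF : D = D' +++ F by rewrite /ccat /= !cat_take_drop -surjective_pairing.
have /gn [E gDE] : level n D' by rewrite /level /= !size_takel ?D1 ?D2 ?leq_addr // !eqxx.
have [||G fG] := @cellular_fine f m (E +++ F) fm.
- by rewrite size_cat size_drop D1 addKn leq_addl.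
- by rewrite size_cat size_drop D2 addKn leq_addl.
by exists G => p; rewrite /= DF emb_cat gDE -emb_cat fG.
Qed.

Lemma digits_transfer u v : exists a (j : int), forall x : R,
  digits 3 v x = a + 3 ^ j * digits 3 u x.
Proof.
exists (digits 3 v 0 - 3 ^ ((size u)%:Z - (size v)%:Z) * digits 3 u 0).
exists ((size u)%:Z - (size v)%:Z) => x.
have n3 : 3 != 0 :> R by [].
rewrite (digits_affine 3 v x) (digits_affine 3 u x) expfzDr //.
rewrite -exprnP -exprnN.
have h : 3 ^+ size u != 0 :> R by rewrite expf_neq0.
by field; rewrite h expf_neq0.
Qed.

Lemma carries_affine f D E : carries f D E -> exists a b j k,
  forall p, set_val (f (emb D p)) = triadic_affine a b j k (set_val (emb D p)).
Proof.
move=> fDE; have [a [j aj]] := digits_transfer D.1 E.1.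
have [b [k bk]] := digits_transfer D.2 E.2.
by exists a, b, j, k => p; rewrite fDE /triadic_affine /= -aj -bk.
Qed.

Lemma triadic_affine_continuous (a b : R) j k : continuous (triadic_affine a b j k).
Proof.
move=> x; apply: (@cvg_pair _ _ _ (nbhs x) (nbhs (a + 3 ^ j * x.1))
  (nbhs (b + 3 ^ k * x.2))); apply: cvgD; try exact: cvg_cst.
- by apply: cvgM; [exact: cvg_cst|exact: cvg_fst].
- by apply: cvgM; [exact: cvg_cst|exact: cvg_snd].
Qed.

(** Cells are open in the Cantor square because of the gaps between them. *)
Lemma cell_near D p : level (size D.1) D ->
  \forall q \near emb D p, exists q', q = emb D q'.
Proof.
move=> /andP[_ /eqP D2]; have [px py] := set_valP p.
have cval : (set_val x : R * R) @[x --> emb D p] --> set_val (emb D p).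
  exact: initial_continuous.
have c1 : (set_val x).1 @[x --> emb D p] --> (set_val (emb D p)).1.
  exact: cvg_comp cval cvg_fst.
have c2 : (set_val x).2 @[x --> emb D p] --> (set_val (emb D p)).2.
  exact: cvg_comp cval cvg_snd.
have e0 : 0 < 3 ^- size D.1 :> R by rewrite invr_gt0 exprn_gt0.
near=> q.
have [qx qy] := set_valP q.
have [x Cx qxE] : exists2 x, cantor_set x & (set_val q).1 = digits 3 D.1 x.
  apply: (cantor_close px qx); rewrite distrC; near: q.
  by move/cvgrPdist_lt : c1; apply.
have [y Cy qyE] : exists2 x, cantor_set x & (set_val q).2 = digits 3 D.2 x.
  apply: (cantor_close py qy); rewrite distrC D2; near: q.
  by move/cvgrPdist_lt : c2; apply.
by exists (mkpoint Cx Cy); apply: point_eqP.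
Unshelve. all: by end_near. Qed.

Lemma cellular_continuous f : cellular f -> continuous f.
Proof.
move=> [m fm]; apply: continuous_comp_initial => p /=.
have [D [q [Dm ->]]] := level_cover m p.
have [E fDE] := fm _ Dm.
have [a [b [j [k fE]]]] := carries_affine fDE.
rewrite /continuous_at /= fE.
apply: (@cvg_trans _ (triadic_affine a b j k (set_val x) @[x --> emb D q])).
  apply: (@near_eq_cvg _ _ (nbhs (emb D q : cantor_point))).
  have Dm' : level (size D.1) D by case/andP: Dm => /eqP D1 D2; rewrite /level D1 eqxx D2.
  near=> x.
  have [x' ->] : exists x', x = emb D x' by near: x; apply: cell_near.
  exact: esym (fE x').
apply: (@cvg_comp _ _ _ (set_val : cantor_point -> R * R) (triadic_affine a b j k)).
  exact: initial_continuous.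
exact: triadic_affine_continuous.
Unshelve. all: by end_near. Qed.

End Cells.

(** * Transpositions and baker's maps *)

Section Exchanges.
Variable R : realType.
Local Notation cantor_point := (cantor_point R).
Local Notation disj := (disj R).
Local Notation homeo := (homeo (set_type (@cantor_square R))).
Implicit Types (p q : cantor_point) (A B D E U W : cell) (f g : homeo).

Definition in_cell D p := exists q, p = emb D q.

Lemma in_cell_emb D q : in_cell D (emb D q).
Proof. by exists q. Qed.

Lemma in_cell_cat D E p : in_cell (D +++ E) p -> in_cell D p.
Proof. by move=> [q ->]; rewrite emb_cat; exact: in_cell_emb. Qed.

Lemma disj_in_cell D E p : disj D E -> in_cell D p -> ~ in_cell E p.
Proof. by move=> DE [q ->] [q' /DE]. Qed.

(** The common form of the transpositions of two cells and of the baker's maps: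
    two ways of cutting the same region into two cells. *)
Definition exchange A B A' B' := [/\ disj A B, disj A' B' &
  forall p, in_cell A p \/ in_cell B p <-> in_cell A' p \/ in_cell B' p].

Lemma exchange_sym A B A' B' : exchange A B A' B' -> exchange A' B' A B.
Proof. by case=> AB AB' h; split=> // p; rewrite h. Qed.

Definition exch_fun A B A' B' p : cantor_point :=
  if pselect (in_cell A p) is left h then emb A' (sval (cid h)) else
  if pselect (in_cell B p) is left h then emb B' (sval (cid h)) else p.

Section ExchangeFun.
Variables A B A' B' : cell.
Hypothesis ABx : exchange A B A' B'.

Lemma exch_fun1 : carries (exch_fun A B A' B') A A'.
Proof.
move=> q; rewrite /exch_fun; case: pselect => [h|[]]; last exact: in_cell_emb.
by case: (cid h) => q' /= /emb_inj ->.
Qed.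

Lemma exch_fun2 : carries (exch_fun A B A' B') B B'.
Proof.
move=> q; rewrite /exch_fun; case: pselect => [h|_].
  by have [AB _ _] := ABx; case: (disj_in_cell AB h); exact: in_cell_emb.
case: pselect => [h|[]]; last exact: in_cell_emb.
by case: (cid h) => q' /= /emb_inj ->.
Qed.

Lemma exch_fun_out p : ~ in_cell A p -> ~ in_cell B p -> exch_fun A B A' B' p = p.
Proof. by rewrite /exch_fun; case: pselect => // _; case: pselect. Qed.

Lemma exch_fun_cellular : cellular (exch_fun A B A' B').
Proof.
(* A cell of this level that meets [A] or [B] is contained in it. *)
pose m := maxn (maxn (size A.1) (size A.2)) (maxn (size B.1) (size B.2)).
exists m => D /andP[/eqP D1 /eqP D2].
have sub F p q : (size F.1 <= m)%N -> (size F.2 <= m)%N ->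
    emb D p = emb F q -> exists G, D = F +++ G.
  move=> F1 F2 /esym /emb_prefix; rewrite D1 D2 => /(_ F1 F2) [G [-> _]].
  by exists G.
have [[p [q pq]]|NA] := pselect (exists p, in_cell A (emb D p)).
  have [||G ->] := sub A _ _ _ _ pq; try by rewrite /m !leq_max leqnn ?orbT.
  by eexists; apply: carries_cat exch_fun1.
have [[p [q pq]]|NB] := pselect (exists p, in_cell B (emb D p)).
  have [||G ->] := sub B _ _ _ _ pq; try by rewrite /m !leq_max leqnn ?orbT.
  by eexists; apply: carries_cat exch_fun2.
exists D => p; apply: exch_fun_out => h; [apply: NA|apply: NB]; by exists p.
Qed.

End ExchangeFun.

Lemma exch_funK A B A' B' : exchange A B A' B' ->
  cancel (exch_fun A B A' B') (exch_fun A' B' A B).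
Proof.
move=> ABx p; have ABx' := exchange_sym ABx.
have [[q ->]|NA] := pselect (in_cell A p); first by rewrite !exch_fun1.
have [[q ->]|NB] := pselect (in_cell B p).
  by rewrite (exch_fun2 ABx) (exch_fun2 ABx').
have [_ _ /(_ p) h] := ABx.
rewrite [exch_fun A _ _ _ _]exch_fun_out // exch_fun_out // => h'.
  by have [] : in_cell A p \/ in_cell B p by apply/h; left.
by have [] : in_cell A p \/ in_cell B p by apply/h; right.
Qed.

(** The identity is a default value for cells that cannot be exchanged; it makes
    this function total. *)
Definition exch A B A' B' : homeo :=
  if pselect (exchange A B A' B') is left h then
    Homeo (exch_funK h) (exch_funK (exchange_sym h))
      (cellular_continuous (exch_fun_cellular h))
      (cellular_continuous (exch_fun_cellular (exchange_sym h)))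
  else homeo_id _.

Lemma exchE A B A' B' : exchange A B A' B' ->
  exch A B A' B' = exch_fun A B A' B' :> (cantor_point -> cantor_point).
Proof. by rewrite /exch; case: pselect. Qed.

Lemma exch_cellular A B A' B' : cellular (exch A B A' B').
Proof.
rewrite /exch; case: pselect => [h|_]; first exact: exch_fun_cellular.
by exists 0%N => D _; exists D.
Qed.

(** A conjugate of an exchange is the exchange of the images of its cells. *)
Lemma exch_conj g A B A' B' D E D' E' :
    exchange A B A' B' -> exchange D E D' E' ->
    carries g A D -> carries g B E -> carries g A' D' -> carries g B' E' ->
  (g * exch A B A' B' = exch D E D' E' * g)%g.
Proof.
move=> hA hD gA gB gA' gB'; apply: homeoP => p /=.
rewrite !exchE //.
have [[q ->]|NA] := pselect (in_cell A p).
  by rewrite exch_fun1 gA gA' exch_fun1.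
have [[q ->]|NB] := pselect (in_cell B p).
  by rewrite exch_fun2 // gB gB' exch_fun2.
rewrite exch_fun_out // exch_fun_out // => -[q].
  by rewrite -gA => /(can_inj (homeo_funK g)) e; apply: NA; exists q.
by rewrite -gB => /(can_inj (homeo_funK g)) e; apply: NB; exists q.
Qed.

Definition transp U W := exch U W W U.

Lemma exchange_transp U W : disj U W -> exchange U W W U.
Proof. by move=> UW; split=> //; [exact: disj_sym|move=> p; split=> -[]; auto]. Qed.

Section Transposition.
Variables U W : cell.
Hypothesis UW : disj U W.

Lemma transp1 : carries (transp U W) U W.
Proof. by rewrite /carries exchE; [exact: exch_fun1|exact: exchange_transp]. Qed.

Lemma transp2 : carries (transp U W) W U.
Proof. by rewrite /carries exchE; [apply: exch_fun2|]; exact: exchange_transp. Qed.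

Lemma transp_out p : ~ in_cell U p -> ~ in_cell W p -> transp U W p = p.
Proof. by rewrite exchE; [exact: exch_fun_out|exact: exchange_transp]. Qed.

Lemma transp_fix D : disj D U -> disj D W -> carries (transp U W) D D.
Proof.
by move=> DU DW p; apply: transp_out; apply: disj_in_cell; eauto; exact: in_cell_emb.
Qed.

End Transposition.

Lemma transpK U W : disj U W -> (transp U W * transp U W = 1)%g.
Proof.
move=> UW; apply: homeoP => p /=.
have [[q ->]|NA] := pselect (in_cell U p); first by rewrite transp1 // transp2.
have [[q ->]|NB] := pselect (in_cell W p); first by rewrite transp2 // transp1.
by rewrite !transp_out.
Qed.

(** Cuts [D] into its left and right halves and stacks them: the first letter of
    the horizontal word becomes the first letter of the vertical one. *)
Definition baker D := exch (D +++ side true false) (D +++ side true true)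
                           (D +++ side false false) (D +++ side false true).

Lemma in_cell_sides D d p :
  in_cell D p <-> in_cell (D +++ side d false) p \/ in_cell (D +++ side d true) p.
Proof.
split=> [[q ->]|]; last by case; exact: in_cell_cat.
have [b [q' ->]] := side_cover d q; rewrite -emb_cat.
by case: b; [right|left]; exact: in_cell_emb.
Qed.

Lemma exchange_baker D : exchange (D +++ side true false) (D +++ side true true)
                           (D +++ side false false) (D +++ side false true).
Proof.
by split=> [||p]; rewrite -?in_cell_sides //; apply/disj_catl/disj_side.
Qed.

Lemma baker_in D b : carries (baker D) (D +++ side true b) (D +++ side false b).
Proof.
have h := exchange_baker D; rewrite /carries exchE //.
by case: b; [exact: exch_fun2|exact: exch_fun1].
Qed.

Lemma baker_out D p : ~ in_cell D p -> baker D p = p.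
Proof.
have h := exchange_baker D; rewrite (in_cell_sides D true) exchE // => Dp.
by apply: exch_fun_out => h'; apply: Dp; auto.
Qed.

Lemma baker_fix D E : disj E D -> carries (baker D) E E.
Proof.
move=> DE p; apply: baker_out; apply: disj_in_cell; eauto; exact: in_cell_emb.
Qed.

Lemma baker_conj g D E : carries g D E -> (g * baker D = baker E * g)%g.
Proof.
by move=> gDE; apply: exch_conj; try exact: exchange_baker; exact: carries_cat.
Qed.

Lemma transp_conj g A B D E : disj A B -> disj D E ->
  carries g A D -> carries g B E -> (g * transp A B = transp D E * g)%g.
Proof. by move=> AB DE gA gB; apply: exch_conj => //; exact: exchange_transp. Qed.

Lemma transp_sides U W d : disj U W ->
  transp U W = (transp (U +++ side d false) (W +++ side d false) *
                transp (U +++ side d true) (W +++ side d true))%g.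
Proof.
move=> UW; apply: homeoP => p /=.
have UWd b c : disj (U +++ side d b) (W +++ side d c) by exact: disj_cat.
have WUd b c : disj (W +++ side d b) (U +++ side d c).
  exact/disj_sym/disj_cat.
have dd D b : disj (D +++ side d b) (D +++ side d (~~ b)).
  exact/disj_catl/disj_side.
have [[q ->]|NU] := pselect (in_cell U p).
  rewrite transp1 //; have [[] [q' ->]] := side_cover d q; rewrite -!emb_cat.
    rewrite (transp1 (UWd true true)) (transp_fix (UWd false false));
      [by []|exact: WUd|exact: (dd W true)].
  rewrite (transp_fix (UWd true true)) ?(transp1 (UWd false false));
      [by []|exact: (dd U false)|exact: UWd].
have [[q ->]|NW] := pselect (in_cell W p).
  rewrite transp2 //; have [[] [q' ->]] := side_cover d q; rewrite -!emb_cat.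
    rewrite (transp2 (UWd true true)) (transp_fix (UWd false false));
      [by []|exact: (dd U true)|exact: UWd].
  rewrite (transp_fix (UWd true true)) ?(transp2 (UWd false false));
      [by []|exact: WUd|exact: (dd W false)].
have out D E q : ~ in_cell D q -> ~ in_cell (D +++ E) q.
  by move=> ND /in_cell_cat.
rewrite (transp_out UW) // (transp_out (UWd true true)); try exact: out.
by rewrite (transp_out (UWd false false)) //; exact: out.
Qed.

(** Shifting two bits with the baker's map produces them in the reverse order;
    letting it first act within each half keeps them in order. *)
Lemma baker_relation D :
  (baker D * (baker (D +++ side true false) * baker (D +++ side true true)) =
   transp (D +++ side false false +++ side false true)
          (D +++ side false true +++ side false false) * (baker D * baker D))%g.
Proof.
apply: homeoP => p /=.
have dd d b : disj (D +++ side d b) (D +++ side d (~~ b)).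
  exact/disj_catl/disj_side.
set U := _ +++ side false true; set W := _ +++ side false false.
have UW : disj U W by apply/disj_cat; exact: (dd false false).
have [[q ->]|Np] := pselect (in_cell D p); last first.
  have Npd d b : ~ in_cell (D +++ side d b) p by move=> /in_cell_cat.
  have NpU : ~ in_cell U p by move=> /in_cell_cat/in_cell_cat.
  have NpW : ~ in_cell W p by move=> /in_cell_cat/in_cell_cat.
  by rewrite (baker_out (Npd true true)) (baker_out (Npd true false)) (baker_out Np)
    (baker_out Np) (transp_out UW NpU NpW).
have [b [q1 ->]] := side_cover true q; have [c [q2 ->]] := side_cover true q1.
have comm b' c' : D +++ side false b' +++ side true c' =
    D +++ side true c' +++ side false b'.
  by rewrite /ccat /= !cats0.
have inner : baker (D +++ side true false) (baker (D +++ side true true)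
    (emb (D +++ side true b +++ side true c) q2)) =
    emb (D +++ side true b +++ side false c) q2.
  case: b; last by rewrite baker_fix ?baker_in //; apply/disj_cat1; exact: (dd true false).
  by rewrite baker_in baker_fix //; apply/disj_cat1; exact: (dd true true).
rewrite -!emb_cat inner (carries_cat _ (baker_in D b)).
rewrite (carries_cat _ (baker_in D b)) comm (carries_cat _ (baker_in D c)).
case: b c {inner} => [] []; rewrite ?transp1 ?transp2 //.
- by rewrite transp_fix //; [apply/disj_cat; exact: (dd false true)|
     apply/disj_catl; exact: (@disj_side R false true)].
- by rewrite transp_fix //; [apply/disj_catl; exact: (@disj_side R false false)|
     apply/disj_cat; exact: (dd false false)].
Qed.

End Exchanges.

(** * Tilings and partitions into cells *)

(** Patterns with their numbering: the position in the list is the number, and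
    closure under permutations makes every numbering available. *)
Inductive tiling : seq cell -> Prop :=
| tiling_whole : tiling [:: whole]
| tiling_split D d s : tiling (D :: s) ->
    tiling [:: D +++ side d false, D +++ side d true & s]
| tiling_perm s t : perm_eq s t -> tiling s -> tiling t.

Lemma tiling_refine D s t : tiling (D :: s) -> tiling t ->
  tiling (map (ccat D) t ++ s).
Proof.
move=> Ds; elim=> [|E d t' _ IH|t' t'' tt' _ IH] /=; first by rewrite ccat0.
- by rewrite !ccatA; exact: tiling_split.
- by apply: tiling_perm IH; rewrite perm_cat2r perm_map.
Qed.

Lemma tiling_sides d s t : tiling s -> tiling t ->
  tiling (map (ccat (side d false)) s ++ map (ccat (side d true)) t).
Proof.
move=> ts tt; have := tiling_split d tiling_whole.
move=> /tiling_refine /(_ ts) h.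
have {h} h : tiling (side d true :: map (ccat (side d false)) s).
  by apply: tiling_perm h; rewrite perm_catC; case: (d).
by apply: tiling_perm (tiling_refine h tt); rewrite perm_catC.
Qed.

Definition lead d (D : cell) : word := if d then D.1 else D.2.
(** [drop_bit d D] is the cell [D] seen from the half [side d b] of the square
    that contains it, rescaled to the whole square. *)
Definition drop_bit d (D : cell) : cell :=
  if d then (behead D.1, D.2) else (D.1, behead D.2).

Lemma drop_bitK d D : lead d D <> [::] ->
  side d (head false (lead d D)) +++ drop_bit d D = D.
Proof. by case: D d => [[|b u] [|c v]] []. Qed.

Section Partitions.
Variable R : realType.
Local Notation cantor_point := (cantor_point R).
Local Notation homeo := (homeo (set_type (@cantor_square R))).
Local Notation disj := (disj R).
Local Notation origin := (mkpoint (cantor0 R) (cantor0 R)).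
Implicit Types (D E : cell) (s t : seq cell) (l : seq (cell * cell)) (f : homeo).

Definition cell_partition s := [/\ uniq s,
  forall D E, D \in s -> E \in s -> D <> E -> disj D E &
  forall p : cantor_point, exists2 D, D \in s & in_cell D p].

Lemma partition_perm s t : perm_eq s t -> cell_partition s -> cell_partition t.
Proof.
move=> st [us ds cs]; split; first by rewrite -(perm_uniq st).
- by move=> D E; rewrite -!(perm_mem st); exact: ds.
- by move=> p; have [D Ds] := cs p; exists D; rewrite // -(perm_mem st).
Qed.

Lemma disj_neq D E : disj D E -> D <> E.
Proof. by move=> DE e; move: DE; rewrite e => /(@disjxx _ _ origin). Qed.

Lemma tiling_partition s : tiling s -> cell_partition s.
Proof.
elim=> {s} [|D d s _ [us ds cs]|s t st _]; last exact: partition_perm.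
  split=> // [D E|p]; first by rewrite !inE => /eqP -> /eqP ->.
  by exists whole; rewrite ?inE //; exists p; rewrite emb_whole.
have /andP[Ds us'] : (D \notin s) && uniq s := us.
have DE E : E \in s -> disj D E.
  move=> Es; apply: ds; rewrite ?inE ?eqxx ?Es ?orbT // => DE.
  by rewrite DE Es in Ds.
have DEb b E : E \in s -> disj (D +++ side d b) E.
  by move=> /DE; exact: disj_cat1.
have DD b c : b <> c -> disj (D +++ side d b) (D +++ side d c).
  move=> bc; apply: disj_catl.
  have -> : c = ~~ b by case: b c bc => [] [].
  exact: disj_side.
split.
- rewrite !cons_uniq us' !inE andbT negb_or -andbA; apply/and3P; split.
  + by apply/eqP/disj_neq/DD.
  + by apply/negP => /(DEb false)/disj_neq; apply.
  + by apply/negP => /(DEb true)/disj_neq; apply.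
- move=> E F; rewrite !inE.
  have dDb b : E \in s -> disj E (D +++ side d b) by move=> /DEb => /(_ b)/disj_sym.
  have sD G : G \in s -> G \in D :: s by rewrite inE => ->; rewrite orbT.
  case/or3P=> [/eqP -> |/eqP ->|Es]; case/or3P=> [/eqP ->|/eqP ->|Fs] EF //;
    try exact: DD; try exact: DEb; try exact: dDb.
  by apply: ds => //; exact: sD.
- move=> p; have [E] := cs p; rewrite inE => /orP[/eqP ->|Es Ep].
    move=> /(in_cell_sides D d p)[] h.
      by exists (D +++ side d false); rewrite ?inE ?eqxx.
    by exists (D +++ side d true); rewrite ?inE ?eqxx ?orbT.
  by exists E; rewrite // !inE Es !orbT.
Qed.

(** Two rectangles crossing the middle lines of the square in different
    directions would overlap. *)
Lemma partition_lead s : cell_partition s -> whole \notin s ->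
  exists d, forall D, D \in s -> lead d D <> [::].
Proof.
move=> [_ ds _] ws; apply: contrapT => h.
have [D Ds D1] : exists2 D, D \in s & D.1 = [::].
  apply: contrapT => h1; apply: h; exists true => D Ds D1.
  by apply: h1; exists D.
have [E Es E2] : exists2 D, D \in s & D.2 = [::].
  apply: contrapT => h1; apply: h; exists false => E Es E2.
  by apply: h1; exists E.
case: D E Ds Es D1 E2 => [D1 D2] [E1 E2] /= Ds Es D10 E20; subst D1 E2.
have [e|] := pselect (([::], D2) = (E1, [::]) :> cell).
  by case: e => e1 e2; rewrite e2 in Ds; rewrite Ds in ws.
move=> /(ds _ _ Ds Es) /(_ (emb (E1, [::]) origin) (emb ([::], D2) origin)).
by rewrite -!emb_cat /ccat /= !cats0; apply.
Qed.

Lemma partition_half s d b : cell_partition s ->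
  (forall D, D \in s -> lead d D <> [::]) ->
  cell_partition [seq drop_bit d D | D <- s & head false (lead d D) == b].
Proof.
move=> [us ds cs] sd.
have mem E : E \in [seq drop_bit d D | D <- s & head false (lead d D) == b] ->
    side d b +++ E \in s.
  case/mapP => D; rewrite mem_filter => /andP[/eqP <- Ds] ->.
  by rewrite drop_bitK //; exact: sd.
split.
- rewrite map_inj_in_uniq ?filter_uniq // => D E.
  rewrite !mem_filter => /andP[/eqP Db Ds] /andP[/eqP Eb Es] DE.
  by rewrite -(drop_bitK (sd _ Ds)) -(drop_bitK (sd _ Es)) DE Db Eb.
- move=> D E /mem Ds /mem Es DE p q epq.
  have /(ds _ _ Ds Es) /(_ p q) : side d b +++ D <> side d b +++ E.
    by case: (d) D E DE {p q epq Ds Es} => [] [D1 D2] [E1 E2] DE [] e1 e2;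
      apply: DE; rewrite e1 e2.
  by rewrite !emb_cat epq.
- move=> p; have [D Ds] := cs (emb (side d b) p).
  rewrite -{1}(drop_bitK (sd _ Ds)); set c := head _ _ => -[q].
  rewrite emb_cat => e; have [cb|cb] := eqVneq c b.
    move: e; rewrite cb => /emb_inj ->; exists (drop_bit d D); last by exists q.
    by apply: map_f; rewrite mem_filter Ds andbT; apply/eqP.
  have cE : c = ~~ b by move: cb; case: (c) (b) => [] [].
  by move: e; rewrite cE => /disj_side.
Qed.

(** A partition into dyadic rectangles is always obtained by successive
    halvings: one of the two middle lines crosses none of its rectangles, and
    both sides of that line, once rescaled, are partitions into larger dyadic
    rectangles. *)
Lemma partition_tiling s : cell_partition s -> tiling s.
Proof.
suff h n : forall s, (forall D, D \in s -> (size D.1 + size D.2 <= n)%N) ->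
    cell_partition s -> tiling s.
  have [n sn] : exists n, forall D, D \in s -> (size D.1 + size D.2 <= n)%N.
    elim: s => [|D s [n IH]]; first by exists 0%N.
    exists (maxn (size D.1 + size D.2) n) => E; rewrite inE => /orP[/eqP ->|Es].
      exact: leq_maxl.
    by rewrite leq_max IH ?orbT.
  exact: h sn.
(* A cell meets the whole square, so a partition that contains the latter
   contains nothing else. *)
elim: n => [|n IHn] {}s sn ps; have [us ds cs] := ps;
  have [ws|ws] := boolP (whole \in s).
1,3: have sE : perm_eq [:: whole] s;
  last (by apply: tiling_perm sE tiling_whole); apply: uniq_perm => // D;
  rewrite inE; apply/idP/idP => [/eqP -> //|Ds]; apply/eqP; apply: contrapT => DW;
  by have := ds _ _ Ds ws DW origin (emb D origin); rewrite emb_whole.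
- have [D Ds _] := cs origin; have := sn _ Ds; rewrite leqn0 addn_eq0 !size_eq0.
  case: D Ds => D1 D2 Ds /andP[/eqP /= e1 /eqP /= e2].
  by rewrite e1 e2 in Ds; rewrite Ds in ws.
- have [d sd] := partition_lead ps ws.
  pose t b := [seq drop_bit d D | D <- s & head false (lead d D) == b].
  have tt b : tiling (t b).
    apply: IHn; last exact: partition_half.
    move=> E /mapP[D]; rewrite mem_filter => /andP[_ Ds] ->.
    have := sn _ Ds; have := sd _ Ds.
    case: (d) D {Ds} => [] [[|b1 D1] [|b2 D2]] //= _;
      by rewrite ?addSn ?addnS ?ltnS // => /leqW.
  have tE b : map (ccat (side d b)) (t b) = [seq D <- s | head false (lead d D) == b].
    rewrite -map_comp -[RHS]map_id; apply/eq_in_map => D.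
    rewrite mem_filter => /andP[/eqP <- Ds] /=; exact/drop_bitK/sd.
  apply: tiling_perm (tiling_sides d (tt false) (tt true)).
  rewrite !tE (@eq_filter _ (fun D => head false (lead d D) == true)
    (predC (fun D => head false (lead d D) == false))).
    exact/permPl/perm_filterC.
  by move=> D /=; case: head.
Qed.

Lemma grid_partition m : exists2 s, cell_partition s & forall D, D \in s -> level m D.
Proof.
pose s : seq cell := [seq (tval u, tval v) | u <- enum {: m.-tuple bool},
    v <- enum {: m.-tuple bool}].
have sP D : reflect (D \in s) (level m D).
  apply: (iffP andP) => [[D1 D2]|/allpairsP[[u v] [_ _ ->]]] /=; last by rewrite !size_tuple.
  by apply/allpairsP; exists (Tuple D1, Tuple D2); rewrite !mem_enum; case: D D1 D2.
exists s; last by move=> D /sP.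
split.
- by apply: allpairs_uniq; rewrite ?enum_uniq // => -[u v] [u' v'] _ _
    [] /val_inj -> /val_inj ->.
- move=> D E /sP/andP[/eqP D1 /eqP D2] /sP/andP[/eqP E1 /eqP E2] DE p q.
  move=> /emb_prefix; rewrite D1 D2 E1 E2 => /(_ (leqnn _) (leqnn _)) [F [EF _]].
  move: E1 E2; rewrite EF /= !size_cat D1 D2 -[RHS]addn0 => /addnI/size0nil F1.
  rewrite -[RHS]addn0 => /addnI/size0nil F2; apply: DE; rewrite EF.
  by case: F F1 F2 {EF} => F1 F2 /= -> ->; rewrite -[LHS]ccat0.
- by move=> p; have [D [q [/sP Ds ->]]] := level_cover m p; exists D; last exact: in_cell_emb.
Qed.

Definition presents l f := [/\ tiling (unzip1 l), tiling (unzip2 l) &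
  forall D E, (D, E) \in l -> carries f D E].

Lemma presents_sym l f : presents l f ->
  presents [seq (x.2, x.1) | x <- l] (homeo_opp f).
Proof.
move=> [l1 l2 lf]; split; rewrite /unzip1 /unzip2 -?map_comp //.
by move=> D E /mapP[[E' D'] /lf h [-> ->]] p /=; rewrite -h homeo_funK.
Qed.

(** The images of the cells of a fine grid form a partition, and every partition
    is a tiling. *)
Lemma cellular_presents f : cellular f -> exists l, presents l f.
Proof.
move=> [m fm]; have [s ps sm] := grid_partition m; have [us ds cs] := ps.
have /choice [e eP] D : exists E, level m D -> carries f D E.
  by have [/fm[E fDE]|] := boolP (level m D); [exists E|exists D].
have sf D : D \in s -> carries f D (e D) by move=> /sm/eP.
exists [seq (D, e D) | D <- s]; split.
- by rewrite /unzip1 -map_comp map_id; exact: partition_tiling.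
- rewrite /unzip2 -map_comp; apply: partition_tiling; split.
  + rewrite map_inj_in_uniq // => D E Ds Es /= DE; apply: contrapT.
    move=> /(ds _ _ Ds Es) /(_ origin origin); apply.
    by apply: (can_inj (homeo_funK f)); rewrite !sf ?DE.
  + move=> _ _ /mapP[D Ds ->] /mapP[E Es ->] /= DE p q.
    rewrite -!sf // => /(can_inj (homeo_funK f)); apply: ds => // e1.
    by apply: DE; rewrite e1.
  + move=> p; have [D Ds [q pq]] := cs (homeo_inv f p).
    exists (e D); first by rewrite (map_f (fun D => e D)).
    by exists q; rewrite -sf // -pq homeo_invK.
- by move=> D E /mapP[D' Ds [-> ->]]; exact: sf.
Qed.

(** A level beyond the lengths of all words of the source tiling refines it. *)
Lemma presents_cellular l f : presents l f -> cellular f.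
Proof.
move=> [/tiling_partition [_ _ cs] _ lf].
have [m lm] : exists m, forall D, D \in unzip1 l -> (size D.1 <= m)%N && (size D.2 <= m)%N.
  elim: (unzip1 l) => [|D s [n IH]]; first by exists 0%N.
  exists (maxn (maxn (size D.1) (size D.2)) n) => E; rewrite inE => /orP[/eqP ->|Es].
    by rewrite !leq_max !leqnn ?orbT.
  by have /andP[E1 E2] := IH _ Es; rewrite !leq_max E1 E2 !orbT.
exists m => D /andP[/eqP D1 /eqP D2].
have [E El [q /esym e]] := cs (emb D origin).
have /andP[E1 E2] := lm _ El.
have [||F [-> _]] := emb_prefix _ _ e; rewrite ?D1 ?D2 //.
have /mapP[[E' G] /lf fEG /= ->] := El.
by exists (G +++ F); exact: carries_cat.
Qed.

End Partitions.

(** * The group 2V in terms of cells *)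

Section TwoVCellular.
Variable R : realType.
Local Notation cantor_point := (cantor_point R).
Local Notation homeo := (homeo (set_type (@cantor_square R))).
Local Notation origin := (mkpoint (cantor0 R) (cantor0 R)).
Local Notation C := (@cantor_set R).
Implicit Types (D E : cell) (s t : seq cell) (l : seq (cell * cell)) (f : homeo).

Definition rect_of D : rect R :=
  Rect (digits 2 D.1 0) (digits 2 D.1 1) (digits 2 D.2 0) (digits 2 D.2 1).

Lemma rect_of_inj : injective rect_of.
Proof.
move=> [D1 D2] [E1 E2] [] /= h1 h2 h3 h4.
by congr pair; [apply: digits_word_inj h1 h2|apply: digits_word_inj h3 h4].
Qed.

Lemma digits2_mid u : digits 2 u (1 / 2) = (digits 2 u 0 + digits 2 u 1) / 2 :> R.
Proof. by rewrite digits_affine (digits_affine 2 u 1); field; rewrite expf_neq0. Qed.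

Lemma rect_of_side D : [/\
  rect_of (D +++ side true false) = left_half (rect_of D),
  rect_of (D +++ side true true) = right_half (rect_of D),
  rect_of (D +++ side false false) = bottom_half (rect_of D) &
  rect_of (D +++ side false true) = top_half (rect_of D)].
Proof.
have e0 : (0 + 0) / 2 = 0 :> R by lra.
have e1 : (0 + 1) / 2 = 1 / 2 :> R by lra.
have e2 : (2 - 1 + 0) / 2 = 1 / 2 :> R by lra.
have e3 : (2 - 1 + 1) / 2 = 1 :> R by lra.
by rewrite /rect_of /left_half /right_half /bottom_half /top_half /= !cats0
  !digits_cat /= e0 e1 e2 e3 !digits2_mid.
Qed.

Definition rects s : set (rect R) := [set rect_of D | D in [set` s]].

Lemma rects_split D d s : tiling (D :: s) ->
  rects [:: D +++ side d false, D +++ side d true & s] =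
  (rects (D :: s) `\ rect_of D) `|`
    [set rect_of (D +++ side d false); rect_of (D +++ side d true)].
Proof.
move=> /(tiling_partition R) [/andP[Ds _] _ _]; apply/seteqP; split=> Q /=.
  case=> E /=; rewrite !inE => /or3P[/eqP ->|/eqP ->|Es] <-;
    [by right; left|by right; right|left].
  split; first by exists E => //=; rewrite inE Es orbT.
  by move=> /rect_of_inj ED; move: Ds; rewrite -ED Es.
case=> [[[E /=]]|[] ->].
- rewrite inE => /orP[/eqP -> <-|Es <- _]; first by case.
  by exists E => //=; rewrite !inE Es !orbT.
- by exists (D +++ side d false); rewrite //= inE eqxx.
- by exists (D +++ side d true); rewrite //= !inE eqxx orbT.
Qed.

Lemma rects_perm s t : perm_eq s t -> rects s = rects t.
Proof. by move=> st; congr image; apply/seteqP; split=> x /=; rewrite (perm_mem st). Qed.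

Lemma tiling_pattern s : tiling s -> pattern (rects s).
Proof.
elim=> {s} [|D d s Ds IH|s t st _]; last by rewrite (rects_perm st).
  rewrite (_ : rects _ = [set unit_square R]); first exact: pattern_trivial.
  apply/seteqP; split=> Q /=; first by case=> E /=; rewrite inE => /eqP -> <-.
  by move=> ->; exists whole; rewrite //= inE.
rewrite rects_split //; have [e1 e2 e3 e4] := rect_of_side D.
have DD : rects (D :: s) (rect_of D) by exists D; rewrite //= inE eqxx.
by case: d; rewrite ?e1 ?e2 ?e3 ?e4; [exact: pattern_vertical|exact: pattern_horizontal].
Qed.

Lemma pattern_tiling (P : set (rect R)) : pattern P ->
  exists2 s, tiling s & P = rects s.
Proof.
have extract P' Q : (exists2 s, tiling s & P' = rects s) -> P' Q ->
    exists D s, [/\ Q = rect_of D, tiling (D :: s) & P' = rects (D :: s)].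
  move=> [s ts ->] [D /= Ds <-]; exists D, (rem D s).
  split=> //; first exact: tiling_perm (perm_to_rem Ds) ts.
  exact: rects_perm (perm_to_rem Ds).
elim=> {P} [|P Q _ IH PQ|P Q _ IH PQ].
- exists [:: whole]; first exact: tiling_whole.
  apply/seteqP; split=> Q /=; last by case=> E /=; rewrite inE => /eqP -> <-.
  by move=> ->; exists whole; rewrite //= inE.
- have [D [s [-> ts ->]]] := extract _ _ IH PQ; have [e1 e2 _ _] := rect_of_side D.
  by eexists; [exact: (tiling_split true ts)|rewrite rects_split // e1 e2].
- have [D [s [-> ts ->]]] := extract _ _ IH PQ; have [_ _ e1 e2] := rect_of_side D.
  by eexists; [exact: (tiling_split false ts)|rewrite rects_split // e1 e2].
Qed.

(** The numbering of the pattern selects one of the orders of its list of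
    cells. *)
Lemma numbered_tiling n (P : numbered_pattern R n) : exists s,
  [/\ tiling s, size s = n & forall i : 'I_n, P i = rect_of (nth whole s i)].
Proof.
case: P => P /= [PP /pattern_tiling[s ts ->] [Psub Pinj Psurj]].
have /choice [e eP] (i : 'I_n) : exists D, D \in s /\ rect_of D = P i.
  by have [D Ds De] := Psub i I; exists D.
pose s' := [seq e i | i <- enum 'I_n].
have sz : size s' = n by rewrite size_map size_enum_ord.
exists s'; split=> // [|i]; last first.
  by rewrite (nth_map i) ?size_enum_ord // nth_ord_enum (eP i).2.
have [us _ _] := tiling_partition R ts.
apply: tiling_perm ts; apply: uniq_perm => // [|D].
  rewrite map_inj_uniq ?enum_uniq // => i j ij.
  by apply: Pinj; rewrite ?inE // -(eP i).2 -(eP j).2 ij.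
apply/idP/mapP => [Ds|[i _ ->]]; last exact: (eP i).1.
have [i _ Pi] : exists2 i, True & P i = rect_of D.
  by have [|i _ <-] := Psurj (rect_of D); [exists D|exists i].
exists i; rewrite ?mem_enum //; apply: rect_of_inj.
by rewrite (eP i).2.
Qed.

Lemma tiling_numbered s n : tiling s -> size s = n ->
  exists P : numbered_pattern R n, forall i : 'I_n, P i = rect_of (nth whole s i).
Proof.
move=> ts sn.
suff h : set_bij [set: 'I_n] (rects s) (fun i : 'I_n => rect_of (nth whole s i)).
  by exists (NumberedPattern (ex_intro2 (@pattern R)
    (fun P => set_bij setT P _) _ (tiling_pattern ts) h)).
have [us _ _] := tiling_partition R ts; split.
- by move=> i _; exists (nth whole s i) => //=; rewrite mem_nth ?sn.
- move=> i j _ _ /rect_of_inj /eqP; rewrite nth_uniq ?sn // => /eqP.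
  exact: val_inj.
- move=> _ [D /= Ds <-]; have Di : (index D s < n)%N by rewrite -sn index_mem.
  by exists (Ordinal Di) => //=; rewrite nth_index.
Qed.

Definition cell_set D : set (R * R) := [set set_val (emb D p) | p in [set: cantor_point]].

Lemma inf_min (S : set R) x : S x -> (forall y, S y -> x <= y) -> inf S = x.
Proof.
move=> Sx xS; apply/eqP; rewrite eq_le; apply/andP; split.
  by apply: ge_inf => //; exists x.
by apply: lb_le_inf; first by exists x.
Qed.

Lemma sup_max (S : set R) x : S x -> (forall y, S y -> y <= x) -> sup S = x.
Proof.
move=> Sx xS; apply/eqP; rewrite eq_le; apply/andP; split.
  by apply: ge_sup; first by exists x.
by apply: ub_le_sup => //; exists x.
Qed.

Lemma bounding_rect_cell D : bounding_rect (cell_set D) =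
  Rect (digits 3 D.1 0) (digits 3 D.1 1) (digits 3 D.2 0) (digits 3 D.2 1).
Proof.
have one3 : 1 <= 3 :> R by lra.
have mem p : cell_set D (set_val (emb D p)) by exists p.
pose p0 := origin; pose p1 := mkpoint (cantor1 R) (cantor1 R).
have itv (z : R * R) : cell_set D z -> [/\ digits 3 D.1 0 <= z.1,
    z.1 <= digits 3 D.1 1, digits 3 D.2 0 <= z.2 & z.2 <= digits 3 D.2 1].
  move=> [p _ <-]; rewrite /= !digits_le //.
  by have [/cantor_itv/andP[? ?] /cantor_itv/andP[? ?]] := set_valP p.
congr Rect.
- by apply: inf_min => [|_ [z /itv[? ? ? ?] <-] //]; exists (set_val (emb D p0)).
- by apply: sup_max => [|_ [z /itv[? ? ? ?] <-] //]; exists (set_val (emb D p1)).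
- by apply: inf_min => [|_ [z /itv[? ? ? ?] <-] //]; exists (set_val (emb D p0)).
- by apply: sup_max => [|_ [z /itv[? ? ? ?] <-] //]; exists (set_val (emb D p1)).
Qed.

Lemma cell_set_sub D E : cell_set (D +++ E) `<=` cell_set D.
Proof. by move=> _ [p _ <-]; rewrite emb_cat; exists (emb E p). Qed.

Lemma cell_set_side D d b : let B := bounding_rect (cell_set D) in
  cell_set (D +++ side d b) = cell_set D `&` rect_points
    (if d then if b then right_third B else left_third B
     else if b then top_third B else bottom_third B).
Proof.
have one3 : 1 <= 3 :> R by lra.
rewrite /= bounding_rect_cell.
have third u : digits 3 u 0 + (digits 3 u 1 - digits 3 u 0) / 3 = digits 3 u (1 / 3) :> R.
  by rewrite (digits_affine 3 u 1) (digits_affine 3 u (1 / 3)); lra.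
have thirds u : digits 3 u 1 - (digits 3 u 1 - digits 3 u 0) / 3 = digits 3 u (2 / 3) :> R.
  by rewrite (digits_affine 3 u 1) (digits_affine 3 u (2 / 3)); lra.
rewrite /left_third /right_third /bottom_third /top_third /= !third !thirds.
apply/seteqP; split=> z.
  move=> Dz; split; first exact: cell_set_sub Dz.
  case: Dz => p _ <-; have [px py] := set_valP p.
  have [pxD pyD] := set_valP (emb (side d b) p).
  rewrite emb_cat /rect_points; move: px py pxD pyD => /cantor_itv px /cantor_itv py.
  by move=> /cantor_itv pxD /cantor_itv pyD; case: d b pxD pyD => [] [] /= pxD pyD;
    split; rewrite /= in_itv /= !digits_le //; lra.
case=> -[p _ <-] /=; have [c [q ->]] := side_cover d p.
have [/cantor_itv qx /cantor_itv qy] := set_valP q.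
have [<- _|cb h] := eqVneq c b; first by exists q; rewrite // emb_cat.
exfalso; case: h; case: d b c cb => [] [] [] //= _;
  by rewrite !in_itv /= !digits_le //; lra.
Qed.

(** Each division appends a letter to one of the words; the cell is reached by
    making all the vertical divisions before the horizontal ones. *)
Lemma cell_set_part D : cantor_part (rect_of D) (cell_set D).
Proof.
have step E d b : cantor_part (rect_of E) (cell_set E) ->
    cantor_part (rect_of (E +++ side d b)) (cell_set (E +++ side d b)).
  move=> h; rewrite cell_set_side; have [e1 e2 e3 e4] := rect_of_side E.
  by case: d b => [] [] /=; rewrite ?e1 ?e2 ?e3 ?e4; constructor.
have base : cantor_part (rect_of whole) (cell_set whole).
  rewrite (_ : cell_set _ = @cantor_square R); first exact: cantor_part_unit.
  apply/seteqP; split=> [_ [p _ <-]|[x y] [Cx Cy]]; first exact: set_valP.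
  by exists (mkpoint Cx Cy); rewrite // emb_whole.
case: D => u v; elim/last_ind: v => [|v b IHv]; last first.
  have -> : (u, rcons v b) = (u, v) +++ side false b by rewrite /ccat /= cats0 cats1.
  exact: step.
elim/last_ind: u => [//|u b IHu].
have -> : (rcons u b, [::]) = (u, [::]) +++ side true b by rewrite /ccat /= cats1.
exact: step.
Qed.

(** Whatever sequence of divisions leads to a rectangle, it spells the two words
    of the same cell, because the rectangle determines its cell. *)
Lemma cantor_part_cell_set D S : cantor_part (rect_of D) S -> S = cell_set D.
Proof.
suff h Q : cantor_part Q S -> exists2 E, Q = rect_of E & S = cell_set E.
  by move=> /h[E /rect_of_inj -> ->].
elim=> {Q S} [|Q S _ [E -> ->]|Q S _ [E -> ->]|Q S _ [E -> ->]|Q S _ [E -> ->]].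
- exists whole => //; apply/seteqP; split=> [[x y] [Cx Cy]|_ [p _ <-]].
    by exists (mkpoint Cx Cy); rewrite // emb_whole.
  exact: set_valP.
all: have [e1 e2 e3 e4] := rect_of_side E.
- by exists (E +++ side true false); rewrite ?e1 ?cell_set_side.
- by exists (E +++ side true true); rewrite ?e2 ?cell_set_side.
- by exists (E +++ side false false); rewrite ?e3 ?cell_set_side.
- by exists (E +++ side false true); rewrite ?e4 ?cell_set_side.
Qed.

(** An increasing affine map between two affine copies of the Cantor set
    respects their end points, hence is the obvious one. *)
Lemma digits_affine_unique u v (a g : R) : 0 < g ->
  (forall x, C x -> exists2 y, C y & a + g * digits 3 u x = digits 3 v y) ->
  (forall y, C y -> exists2 x, C x & a + g * digits 3 u x = digits 3 v y) ->
  forall x, a + g * digits 3 u x = digits 3 v x.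
Proof.
move=> g0 uv vu; have one3 : 1 <= 3 :> R by lra.
have mono x y : x <= y -> a + g * digits 3 u x <= a + g * digits 3 u y.
  by move=> xy; rewrite lerD2l ler_pM2l // digits_le.
have h0 : a + g * digits 3 u 0 = digits 3 v 0.
  apply/eqP; rewrite eq_le; apply/andP; split.
    have [x /cantor_itv/andP[x0 _] <-] := vu _ (cantor0 R); exact: mono.
  have [y /cantor_itv/andP[y0 _] ->] := uv _ (cantor0 R); by rewrite digits_le.
have h1 : a + g * digits 3 u 1 = digits 3 v 1.
  apply/eqP; rewrite eq_le; apply/andP; split.
    have [y /cantor_itv/andP[_ y1] ->] := uv _ (cantor1 R); by rewrite digits_le.
  have [x /cantor_itv/andP[_ x1] <-] := vu _ (cantor1 R); exact: mono.
move=> x; rewrite digits_affine (digits_affine 3 v x) -h0.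
have : g * 3 ^- size u = 3 ^- size v.
  move: h1; rewrite digits_affine (digits_affine 3 v 1) -h0 !mulr1; lra.
by move=> <-; ring.
Qed.

Lemma triadic_affine_unique D E a b j k :
  triadic_affine a b j k @` cell_set D = cell_set E ->
  forall p : cantor_point, triadic_affine a b j k (set_val (emb D p)) = set_val (emb E p).
Proof.
move=> DE.
have DE1 p : exists q : cantor_point,
    triadic_affine a b j k (set_val (emb D p)) = set_val (emb E q).
  have : cell_set E (triadic_affine a b j k (set_val (emb D p))).
    by rewrite -DE; exists (set_val (emb D p)) => //; exists p.
  by move=> [q _ <-]; exists q.
have DE2 q : exists p : cantor_point,
    triadic_affine a b j k (set_val (emb D p)) = set_val (emb E q).
  have : cell_set E (set_val (emb E q)) by exists q.
  by rewrite -DE => -[_ [p _ <-] <-]; exists p.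
have n3 i : 0 < (3 : R) ^ (i : int) by rewrite exprz_gt0.
move=> p; rewrite /triadic_affine /=; congr pair.
- apply: digits_affine_unique => // x Cx.
  + have [q [e _]] := DE1 (mkpoint Cx (cantor0 R)); have [qx _] := set_valP q.
    by exists (set_val q).1.
  + have [q [e _]] := DE2 (mkpoint Cx (cantor0 R)); have [qx _] := set_valP q.
    by exists (set_val q).1.
- apply: digits_affine_unique => // x Cx.
  + have [q [_ e]] := DE1 (mkpoint (cantor0 R) Cx); have [_ qx] := set_valP q.
    by exists (set_val q).2.
  + have [q [_ e]] := DE2 (mkpoint (cantor0 R) Cx); have [_ qx] := set_valP q.
    by exists (set_val q).2.
Qed.

Lemma twoV_presents f : twoV R f <-> exists l, presents l f.
Proof.
split=> [[n [P1 [P2 h]]]|[l [l1 l2 lf]]].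
- have [s [ts sn P1s]] := numbered_tiling P1; have [t [tt tn P2t]] := numbered_tiling P2.
  have st : size s = size t by rewrite sn tn.
  exists (zip s t); rewrite /presents unzip1_zip ?unzip2_zip ?st //; split=> // D E.
  move=> /(nthP (whole, whole))[i]; rewrite size_zip st minnn tn => ilt.
  rewrite nth_zip // => -[<- <-] p; have := h (Ordinal ilt).
  rewrite P1s P2t /= => -[S [T [/cantor_part_cell_set -> /cantor_part_cell_set ->]]].
  move=> [a [b [j [k [DE fE]]]]]; apply: val_inj.
  by rewrite /= -[LHS]/(set_val _) fE ?(triadic_affine_unique DE) //; exists p.
- have [P1 P1E] := tiling_numbered l1 erefl; have [P2 P2E] := tiling_numbered l2 erefl.
  have sz : size (unzip2 l) = size (unzip1 l) by rewrite !size_map.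
  exists (size (unzip1 l)); move: P2 P2E; rewrite sz => P2 P2E.
  exists P1, P2 => i; rewrite P1E P2E.
  set D := nth _ _ _; set E := nth _ _ _.
  exists (cell_set D), (cell_set E); split; try exact: cell_set_part.
  have fDE : carries f D E.
    apply: lf; have il : (i < size l)%N by rewrite -(size_map fst).
    have -> : (D, E) = nth (whole, whole) l i.
      rewrite /D /E (nth_map (whole, whole)) // (nth_map (whole, whole)) //.
      by rewrite -surjective_pairing.
    exact: mem_nth.
  have [a [b [j [k fE]]]] := carries_affine fDE; exists a, b, j, k; split.
    apply/seteqP; split=> [_ [_ [p _ <-] <-]|_ [p _ <-]].
      by rewrite -fE fDE; exists p.
    by exists (set_val (emb D p)); [exists p|rewrite -fE fDE].
  move=> p [q _ /val_inj <-]; exact: fE.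
Qed.

Lemma twoV_cellular f : twoV R f <-> cellular f.
Proof.
rewrite twoV_presents; split; last exact: cellular_presents.
by case=> l; exact: presents_cellular.
Qed.

Lemma twoV_subgroup : subgroup (twoV R).
Proof.
have mul f g : twoV R f -> twoV R g -> twoV R (f * g)%g.
  by rewrite !twoV_cellular; exact: cellular_comp.
have inv f : twoV R f -> twoV R (f^-1)%g.
  by rewrite !twoV_presents => -[l /presents_sym h]; eexists; exact: h.
split=> [|f g].
  by rewrite inE; apply/twoV_cellular; exists 0%N => D _; exists D.
by rewrite !inE => Gf Gg; apply: mul => //; exact: inv.
Qed.

Lemma twoV_exch A B A' B' : twoV R (exch R A B A' B').
Proof. by apply/twoV_cellular; exact: exch_cellular. Qed.

End TwoVCellular.

(** * Normal subgroups of 2V *)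

(** Inversion of the construction of tilings: the last division made is visible
    up to the order of the cells. *)
Lemma tiling_last_split s : tiling s -> s = [:: whole] \/
  exists D d r, tiling (D :: r) /\ perm_eq [:: D +++ side d false, D +++ side d true & r] s.
Proof.
elim=> {s} [|D d s Ds _|s t st _ [sE|[D [d [r [Dr rs]]]]]]; first by left.
- by right; exists D, d, s.
- by left; apply/perm_small_eq; rewrite // perm_sym -sE.
- by right; exists D, d, r; split=> //; exact: perm_trans rs st.
Qed.

Section Matching.
Variable R : realType.
Local Notation cantor_point := (cantor_point R).
Local Notation homeo := (homeo (set_type (@cantor_square R))).
Local Notation disj := (disj R).
Local Notation origin := (mkpoint (cantor0 R) (cantor0 R)).
Local Notation transp := (transp R).
Local Notation baker := (baker R).
Implicit Types (D E U W : cell) (s t : seq cell) (f g : homeo).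

Definition matches f s t := size s = size t /\
  forall i, (i < size s)%N -> carries f (nth whole s i) (nth whole t i).

Lemma matches_comp f g s t u : matches f s t -> matches g t u ->
  matches (g * f)%g s u.
Proof.
move=> [st fst] [tu gtu]; split=> [|i si p]; first by rewrite st.
by rewrite /= fst // gtu -?st.
Qed.

Lemma matches_cons f D E s t :
  matches f (D :: s) (E :: t) <-> carries f D E /\ matches f s t.
Proof.
split=> [[[st] h]|[DE [st h]]].
  by split; [exact: (h 0%N)|split=> // i si; exact: (h i.+1)].
by split=> [|[|i] si //=]; [rewrite /= st|exact: h].
Qed.

Lemma matches_id f s : (forall D, D \in s -> carries f D D) -> matches f s s.
Proof. by move=> h; split=> // i si; apply/h/mem_nth. Qed.

Definition disjoint_family n (Y : nat -> cell) :=
  forall i j, (i < n)%N -> (j < n)%N -> i <> j -> disj (Y i) (Y j).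

(** An unlimited supply of disjoint subcells of [D]: none of the words formed by
    ones followed by a zero is a prefix of another. *)
Definition comb D (i : nat) : cell := D +++ (rcons (nseq i true) false, [::]).

Lemma comb_disjoint n D : disjoint_family n (comb D).
Proof.
suff h i k : disj (comb D i) (comb D (i + k.+1)).
  move=> i j _ _; case: (ltngtP i j) => // ij _.
    by rewrite -(subnK ij) addnC addSnnS.
  by apply: disj_sym; rewrite -(subnK ij) addnC addSnnS.
rewrite /comb nseqD rcons_cat /= -cat1s -(cats1 _ false).
have -> w : D +++ (nseq i true ++ w, [::]) = D +++ (nseq i true, [::]) +++ (w, [::]).
  by rewrite -ccatA /ccat.
have -> w : D +++ (nseq i true ++ [:: true] ++ w, [::]) =
    D +++ (nseq i true, [::]) +++ side true true +++ (w, [::]).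
  by rewrite -!ccatA /ccat.
by apply/disj_sym/disj_cat1/disj_catl; exact: (@disj_side R true true).
Qed.

(** Since the sources and targets are all disjoint, the product of the
    transpositions of [Y i] and [Z i] does it. *)
Lemma twoV_move n (Y Z : nat -> cell) :
  disjoint_family n Y -> disjoint_family n Z ->
  (forall i j, (i < n)%N -> (j < n)%N -> disj (Y i) (Z j)) ->
  exists2 g, twoV R g & forall i, (i < n)%N -> carries g (Y i) (Z i).
Proof.
move=> YY ZZ YZ.
suff h m : (m <= n)%N -> exists g, [/\ twoV R g,
    forall i, (i < m)%N -> carries g (Y i) (Z i) &
    forall D, (forall i, (i < m)%N -> disj D (Y i) /\ disj D (Z i)) -> carries g D D].
  by have [g [Gg gYZ _]] := h n (leqnn n); exists g.
elim: m => [|m IHm] mn.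
  by exists 1%g; split=> //; have [] := twoV_subgroup R; rewrite inE.
have [g [Gg gYZ gfix]] := IHm (ltnW mn).
have YZm : disj (Y m) (Z m) by exact: YZ.
exists (transp (Y m) (Z m) * g)%g; split.
- have /group_closedM := twoV_subgroup R => mul; apply/set_mem/mul; rewrite inE //.
  exact: twoV_exch.
- move=> i; rewrite ltnS leq_eqVlt => /orP[/eqP ->|im] p /=.
    rewrite gfix ?transp1 // => i' im'; have i'n := ltn_trans im' mn.
    by split; [apply: YY => // e|exact: YZ]; rewrite e ltnn in im'.
  rewrite gYZ // transp_fix //; have inn := ltn_trans im mn.
    exact/disj_sym/YZ.
  by apply: ZZ => // e; rewrite e ltnn in im.
- move=> D hD p /=; rewrite gfix => [|i im]; last by apply: hD; rewrite ltnS ltnW.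
  by have [DY DZ] := hD m (ltnSn m); rewrite transp_fix.
Qed.

Section Normal.
Variable N : set homeo.
Hypothesis Nnormal : normal_subgroup N (twoV R).

Let NV f : N f -> N (f^-1)%g.
Proof. by case: Nnormal => /group_closedV h _ _ /mem_set/h /set_mem. Qed.

Let NM f g : N f -> N g -> N (f * g)%g.
Proof.
case: Nnormal => /group_closedM h _ _ /mem_set Nf /mem_set Ng.
by apply: set_mem; exact: h.
Qed.

Let N1 : N 1%g.
Proof. by case: Nnormal => -[]; rewrite inE. Qed.

Let NG f : N f -> twoV R f.
Proof. by case: Nnormal => _ h _ /h. Qed.

Let NJ f g : N f -> twoV R g -> N (g * f * g^-1)%g.
Proof.
case: Nnormal => _ _ h Nf Gg; have : twoV R (g^-1)%g.
  have /group_closedV := twoV_subgroup R => /(_ g); rewrite !inE; exact.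
by move=> /(h _ _ Nf); rewrite conjgE invgK mulgA.
Qed.

(** The products of two disjoint transpositions are convenient because they are
    commutators, and because a single transposition is one of them after
    division of its cells. *)
Definition double_transp (Y : nat -> cell) : homeo :=
  (transp (Y 0%N) (Y 1%N) * transp (Y 2%N) (Y 3%N))%g.

Lemma double_transp_move Y Z : disjoint_family 4 Y -> disjoint_family 4 Z ->
  (forall i j, (i < 4)%N -> (j < 4)%N -> disj (Y i) (Z j)) ->
  N (double_transp Y) -> N (double_transp Z).
Proof.
move=> YY ZZ YZ NY; have [g Gg gYZ] := twoV_move YY ZZ YZ.
have e i j : (i < 4)%N -> (j < 4)%N -> i <> j ->
    (g * transp (Y i) (Y j) = transp (Z i) (Z j) * g)%g.
  by move=> i4 j4 ij; apply: transp_conj; [exact: YY|exact: ZZ|exact: gYZ|exact: gYZ].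
have -> : double_transp Z = (g * double_transp Y * g^-1)%g.
  by rewrite /double_transp mulgA e // -(mulgA _ g (transp _ _)) e // mulgA mulgK.
exact: NJ.
Qed.

(** A nontrivial [f] moves some cell [A] to a disjoint cell [B]. For a
    transposition [t] of two subcells of [A], the commutator [f t f^-1 t^-1] is
    in [N], and is the product of [t] with the corresponding transposition in
    [B]. Only the half [side true false] of [A] is used, in order to leave room
    in the other half, [S]. *)
Lemma double_transp_seed f : N f -> f <> 1%g -> exists Y S,
  [/\ disjoint_family 4 Y, forall i, (i < 4)%N -> disj (Y i) S & N (double_transp Y)].
Proof.
move=> Nf f1.
have [D [E [DE fDE]]] : exists D E, D <> E /\ carries f D E.
  have /twoV_cellular[m fm] := NG Nf; apply: contrapT => h; apply: f1.
  apply: homeoP => p; have [D [q [Dm ->]]] := level_cover m p.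
  have [E fDE] := fm _ Dm; rewrite fDE.
  by have [->//|DE] := pselect (D = E); case: h; exists D, E.
have [F AB] := disj_sep R DE.
have fAB : carries f (D +++ F) (E +++ F) by exact: carries_cat.
move: (D +++ F) (E +++ F) AB fAB => A B AB fAB.
pose a b (A : cell) := A +++ side true false +++ side true b.
have aa b X : disj (a b X) (a (~~ b) X) by apply/disj_catl/disj_side.
have ab b c : disj (a b A) (a c B) by rewrite /a -!ccatA; exact: disj_cat.
have fa b : carries f (a b A) (a b B) by rewrite /a -!ccatA; exact: carries_cat.
exists (nth whole [:: a false B; a true B; a false A; a true A]), (A +++ side true true).
split.
- move=> [|[|[|[|i]]]] [|[|[|[|j]]]] //= _ _ _;
  by [exact: (aa false)|exact: (aa true)|exact: ab|exact/disj_sym/ab].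
- move=> [|[|[|[|i]]]] //= _;
    try (by apply/disj_cat1/disj_catl; exact: (@disj_side R true false)).
    by rewrite /a -ccatA; apply/disj_sym/disj_cat.
  by rewrite /a -ccatA; apply/disj_sym/disj_cat.
- rewrite /double_transp /=.
  have e : (f * transp (a false A) (a true A) = transp (a false B) (a true B) * f)%g.
    apply: transp_conj => //; by [exact: (aa false A)|exact: (aa false B)].
  have tt := transpK (aa false A).
  have -> : (transp (a false B) (a true B) * transp (a false A) (a true A) =
     f * (transp (a false A) (a true A) * f^-1 * (transp (a false A) (a true A))^-1))%g.
    rewrite !mulgA e mulgK; congr (_ * _)%g.
    by apply: (@mulgI _ (transp (a false A) (a true A))); rewrite tt mulgV.
  by apply: NM => //; apply: NJ; [exact: NV|exact: twoV_exch].
Qed.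

Hypothesis Nnontrivial : exists2 f, N f & f <> 1%g.

(** Moving the four cells through [S] is possible as soon as the target is
    disjoint from a part of [S], which holds for a small part of any cell. *)
Lemma double_transp_comb E : exists F, N (double_transp (comb (E +++ F))).
Proof.
have [f Nf f1] := Nnontrivial.
have [Y [S [YY YS NY]]] := double_transp_seed Nf f1.
have [F [G SE]] := disj_sub R S E; exists G.
apply: (double_transp_move (@comb_disjoint 4 (S +++ F))); try exact: comb_disjoint.
  by move=> i j _ _; exact: disj_cat.
apply: (double_transp_move YY (@comb_disjoint 4 _)) NY => i j i4 _.
rewrite /comb -ccatA; apply/disj_sym/disj_cat1/disj_sym; exact: YS.
Qed.

(** Once the cells are halved the transposition is a product of two, and its
    four cells can be reached from four cells inside the free cell [E]. *)
Lemma transp_N_proper U W E : disj U W -> disj E U -> disj E W -> N (transp U W).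
Proof.
move=> UW EU EW; have [F NE] := double_transp_comb E.
pose u b := U +++ side true b; pose w b := W +++ side true b.
rewrite (transp_sides true UW) -/(u false) -/(u true) -/(w false) -/(w true).
have uu b : disj (u b) (u (~~ b)) by apply/disj_catl/disj_side.
have ww b : disj (w b) (w (~~ b)) by apply/disj_catl/disj_side.
have uw b c : disj (u b) (w c) by exact: disj_cat.
pose Z := nth whole [:: u false; w false; u true; w true].
apply: (@double_transp_move _ Z (@comb_disjoint 4 _)) NE.
- move=> [|[|[|[|i]]]] [|[|[|[|j]]]] //= _ _ _;
  by [exact: (uu false)|exact: (uu true)|exact: (ww false)|exact: (ww true)
     |exact: uw|exact/disj_sym/uw].
- by move=> i [|[|[|[|j]]]] //= _ _; rewrite /comb -ccatA; exact: disj_cat.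
Qed.

(** The two cells may cover the square; but each half of the transposition
    leaves half of [U] free. *)
Lemma transp_N U W : disj U W -> N (transp U W).
Proof.
move=> UW; rewrite (transp_sides true UW).
have UU b : disj (U +++ side true b) (U +++ side true (~~ b)).
  exact/disj_catl/disj_side.
apply: NM.
- by apply: (transp_N_proper (E := U +++ side true true)); [exact: disj_cat
    |exact: (UU true)|exact: disj_cat].
- by apply: (transp_N_proper (E := U +++ side true false)); [exact: disj_cat
    |exact: (UU false)|exact: disj_cat].
Qed.

(** The two baker's maps are conjugate by the transposition of [D] and [E], which
    is trivial modulo [N]. *)
Lemma baker_cong D E : disj D E -> exists2 n, N n & (baker E = n * baker D)%g.
Proof.
move=> DE; set t := transp D E.
have Nt : N t by exact: transp_N.
have e : (t * baker D = baker E * t)%g by apply/baker_conj/transp1.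
exists (t * (baker D * t^-1 * (baker D)^-1))%g.
  by apply: NM => //; apply: NJ; [exact: NV|exact: twoV_exch].
by rewrite !mulgA e mulgK mulgVK.
Qed.

(** Modulo [N] the baker's map of [D] agrees with that of any other cell
    disjoint from [E], in particular with those of the two halves of [D]. The
    relation then says that its cube is equal to its square. *)
Lemma baker_N_proper D E : disj D E -> N (baker D).
Proof.
move=> DE; have [n Nn bE] := baker_cong DE.
have cong b : exists2 n, N n & (baker (D +++ side true b) = n * baker D)%g.
  have /baker_cong[m Nm ->] : disj E (D +++ side true b).
    exact/disj_sym/disj_cat1.
  by exists (m * n)%g; [exact: NM|rewrite bE mulgA].
have [n0 N0 e0] := cong false; have [n1 N1' e1] := cong true.
have := baker_relation R D; rewrite e0 e1; set s := transp _ _; set b := baker D => h.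
have Ns : N s.
  by apply/transp_N/disj_cat/disj_catl; exact: (@disj_side R false false).
have -> : b = (n0^-1 * (b^-1 * s * b) * n1^-1)%g.
  apply: (@mulgI _ (b * n0)%g); apply: (@mulIg _ n1); apply: (@mulIg _ b).
  rewrite -!mulgA in h *; rewrite h !mulgA mulgK mulgV mul1g mulgVK.
  by [].
apply: NM; last exact: NV.
apply: NM; first exact: NV.
have Gb : twoV R b by exact: twoV_exch.
have GV : twoV R (b^-1)%g.
  have /group_closedV := twoV_subgroup R => /(_ b); rewrite !inE; exact.
by have := NJ Ns GV; rewrite invgK.
Qed.

(** Now the two halves of [D], which are proper cells, have their baker's maps in
    [N], and the relation says that the baker's map of [D] is equal to its square
    modulo [N]. *)
Lemma baker_N D : N (baker D).
Proof.
have dd b : disj (D +++ side true b) (D +++ side true (~~ b)).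
  exact/disj_catl/disj_side.
have N0 : N (baker (D +++ side true false)) by exact: baker_N_proper (dd false).
have N1' : N (baker (D +++ side true true)) by exact: baker_N_proper (dd true).
have := baker_relation R D; set n := (baker _ * baker (_ +++ side true true))%g.
have Nn : N n by exact: NM.
set s := transp _ _; set b := baker D => h.
have Ns : N s.
  by apply/transp_N/disj_cat/disj_catl; exact: (@disj_side R false false).
have -> : b = (s^-1 * (b * n * b^-1))%g by rewrite h !mulgA mulVg mul1g mulgK.
by apply: NM; [exact: NV|apply: NJ => //; exact: twoV_exch].
Qed.

(** Turns a division of [D] into a division in another direction; this is the
    only difference between tilings with the same number of cells that
    transpositions do not account for. *)
Lemma rebaker_N D d d' : exists2 h, N h &
  (forall b, carries h (D +++ side d b) (D +++ side d' b)) /\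
  (forall E, disj E D -> carries h E E).
Proof.
case: d d' => [] [].
- by exists 1%g.
- exists (baker D); first exact: baker_N.
  by split=> [b|E ED]; [exact: baker_in|exact: baker_fix].
- exists (baker D)^-1%g; first exact/NV/baker_N.
  split=> [b|E ED] p; apply: (can_inj (homeo_funK (baker D))).
    by rewrite [LHS]homeo_invK baker_in.
  by rewrite [LHS]homeo_invK baker_fix.
- by exists 1%g.
Qed.

(** Selection sort by transpositions: at each stage the cells are only permuted,
    so that one more of them can be put in its place. *)
Lemma shuffle_N s t : tiling s -> perm_eq s t -> exists2 g, N g & matches g s t.
Proof.
move=> ts st; have [us ds _] := tiling_partition R ts.
have sz := perm_size st; have ut : uniq t by rewrite -(perm_uniq st).
suff h k : exists2 g, N g & (forall i, (i < k)%N -> (i < size s)%N ->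
     carries g (nth whole s i) (nth whole t i)) /\
     (forall D, D \in s -> exists2 E, E \in s & carries g D E).
  by have [g Ng [gst _]] := h (size s); exists g => //; split=> // i si; exact: gst.
elim: k => [|k [g Ng [gst gss]]].
  by exists 1%g => //; split=> // D Ds; exists D.
have [sk|ks] := leqP (size s) k.
  by exists g => //; split=> // i _ si; apply: gst => //; exact: leq_trans si sk.
have [E Es gE] := gss _ (mem_nth whole ks).
have ts' i : (i < size s)%N -> nth whole t i \in s.
  by move=> si; rewrite (perm_mem st) mem_nth // -sz.
have [Et|Et] := pselect (E = nth whole t k).
  exists g => //; split=> // i; rewrite ltnS leq_eqVlt => /orP[/eqP ->|ik] si.
    by rewrite -Et.
  exact: gst.
have dE : disj E (nth whole t k) by apply: ds => //; exact: ts'.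
exists (transp E (nth whole t k) * g)%g; first by apply: NM => //; exact: transp_N.
split=> [i|D /gss[F Fs gF]].
  rewrite ltnS leq_eqVlt => /orP[/eqP ->|ik] si p /=.
    by rewrite gE transp1.
  rewrite gst // transp_fix //; apply: (ds); rewrite ?ts' //.
    move=> tE; have := gE p; rewrite -tE -gst // => /(can_inj (homeo_funK g)).
    apply: ds; rewrite ?mem_nth //; apply/eqP; rewrite nth_uniq //.
    by rewrite neq_ltn ik orbT.
  by apply/eqP; rewrite nth_uniq -?sz // neq_ltn ik.
have [FE|FE] := pselect (F = E).
  by exists (nth whole t k); [exact: ts'|move=> p /=; rewrite gF FE transp1].
have [Ft|Ft] := pselect (F = nth whole t k).
  by exists E => // p /=; rewrite gF Ft transp2.
by exists F => // p /=; rewrite gF transp_fix //; apply: ds => //; exact: ts'.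
Qed.

(** By induction on the number of cells. The last divisions of the two tilings
    can be undone and matched with each other, whatever cells they divided,
    because the order of the cells is irrelevant modulo [N]; if they have
    different directions, a baker's map corrects this. *)
Lemma tilings_N s t : tiling s -> tiling t -> size s = size t ->
  exists2 g, N g & matches g s t.
Proof.
have [n] := ubnP (size s); elim: n s t => // n IHn s t; rewrite ltnS => sn ts tt st.
have [sE|[D [d [r [tr rs]]]]] := tiling_last_split ts;
  have [tE|[E [d' [r' [tr' rt]]]]] := tiling_last_split tt.
- by exists 1%g => //; rewrite sE tE; exact: matches_id.
- by move: st; rewrite sE -(perm_size rt).
- by move: st; rewrite tE -(perm_size rs).
- have szr : size (D :: r) = size (E :: r').
    by move: st; rewrite -(perm_size rs) -(perm_size rt) /= => -[] ->.
  have szn : (size (D :: r) < n)%N by rewrite (leq_trans _ sn) // -(perm_size rs).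
  have [g Ng /matches_cons[gDE grr]] := IHn _ _ szn tr tr' szr.
  have [h Nh [hE hfix]] := rebaker_N E d d'.
  have hg : matches (h * g)%g [:: D +++ side d false, D +++ side d true & r]
      [:: E +++ side d' false, E +++ side d' true & r'].
    apply: (@matches_comp _ _ _ [:: E +++ side d false, E +++ side d true & r']).
      by apply/matches_cons; split; [exact: carries_cat|apply/matches_cons; split;
         [exact: carries_cat|]].
    apply/matches_cons; split; first exact: hE.
    apply/matches_cons; split; first exact: hE.
    apply: matches_id => F Fr; apply: hfix.
    have [/= /andP[Er' _] dr' _] := tiling_partition R tr'.
    apply: dr'; rewrite ?inE ?eqxx ?Fr ?orbT // => FE.
    by rewrite -FE Fr in Er'.
  have [g1 N1' m1] := shuffle_N ts (etrans (perm_sym _ _) rs).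
  have [g2 N2 m2] := shuffle_N (tiling_split d' tr') rt.
  exists (g2 * ((h * g) * g1))%g; first by do !apply: NM.
  exact: matches_comp (matches_comp m1 hg) m2.
Qed.

Lemma normal_full : N = twoV R.
Proof.
apply/seteqP; split=> [f|f]; first exact: NG.
move=> /twoV_presents[l [l1 l2 lf]].
have sz : size (unzip1 l) = size (unzip2 l) by rewrite !size_map.
have [g Ng [_ gl]] := tilings_N l1 l2 sz.
suff -> : f = g by [].
have [_ _ cl] := tiling_partition R l1.
apply: homeoP => p; have [D Dl [q ->]] := cl p.
have il : (index D (unzip1 l) < size (unzip1 l))%N by rewrite index_mem.
have := gl _ il; rewrite nth_index // => ->.
apply: lf; have il' : (index D (unzip1 l) < size l)%N by rewrite -(size_map fst).
have -> : (D, nth whole (unzip2 l) (index D (unzip1 l))) =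
    nth (whole, whole) l (index D (unzip1 l)).
  rewrite -{1}(nth_index whole Dl) !(nth_map (whole, whole)) //.
  by rewrite -surjective_pairing.
exact: mem_nth.
Qed.

End Normal.

Lemma twoV_nontrivial : twoV R <> [set 1%g].
Proof.
move=> G1; have d := @disj_side R true false.
have : twoV R (transp (side true false) (side true true)) by exact: twoV_exch.
rewrite G1 /= => t1; have := transp1 d origin; rewrite t1 => /esym.
exact: disj_sym d origin origin.
Qed.

End Matching.

Theorem theorem1 (R : realType) : simple_group (twoV R).
Proof.
split; [exact: twoV_subgroup|exact: twoV_nontrivial|move=> N Nn].
have [Nt|N1] := pselect (exists2 f, N f & f <> 1%g); first by right; exact: normal_full.
left; apply/seteqP; split=> [f Nf|f ->]; last by case: Nn => -[]; rewrite inE.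
by apply: contrapT => f1; apply: N1; exists f.
Qed.
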